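(* Let $q\geq 2$ be an integer and let $G$ be a finite group with $\Gamma^q(G)\neq 1$. Then $\chi(E(q,G))=P_q(G,-1)$.
   Context: The lower central series of a group $K$ is $\Gamma^1(K)=K$, $\Gamma^q(K)=[\Gamma^{q-1}(K),K]$. $E(q,G)$ is the geometric realization of the simplicial set whose set of $n$-simplices is $E_n(q,G)=\{(g_0,g_1,\ldots,g_n)\in G^{n+1} : \Gamma^q(\langle g_1,\ldots,g_n\rangle)=1\}$, with face maps $d_i(g_0,\ldots,g_n)=(g_0,\ldots,g_ig_{i+1},\ldots,g_n)$ for $0\le i<n$, $d_n(g_0,\ldots,g_n)=(g_0,\ldots,g_{n-1})$, and degeneracies $s_j(g_0,\ldots,g_n)=(g_0,\ldots,g_j,e,g_{j+1},\ldots,g_n)$ for $0\le j\le n$. $\chi$ denotes the Euler characteristic; $E(q,G)$ has the homotopy type of a finite complex. For integers $s\ge 1$, $P_q(G,s)=|\{(g_1,\ldots,g_s)\in G^s : \Gamma^q(\langle g_1,\ldots,g_s\rangle)=1\}|/|G|^s$. It is regarded as a function of a complex variable $s$ through the (unique) finite Dirichlet series agreeing with it at all positive integers, namely $P_q(G,s)=-\sum_{A\in \mathcal{N}_q(G)}\mu_q(A,G)\,|G:A|^{-s}$; here $\mathcal{N}_q(G)$ is the poset, ordered by inclusion, of proper subgroups $H$ of $G$ with $\Gamma^q(H)=1$, and $\mu_q$ is the M\''obius function of $\mathcal{L}_q(G)=\mathcal{N}_q(G)\cup\{G\}$, determined by $\mu_q(a,a)=1$ and $\mu_q(a,b)=-\sum_{a\le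 u<b}\mu_q(a,u)$ for $a<b$. $P_q(G,-1)$ is the value of this series at $s=-1$. *)

(* Defs.v *)
From HB Require Import structures.
From mathcomp Require Import all_boot all_order all_algebra all_fingroup all_solvable.
From mathcomp Require Import generic_quotient complex.
From mathcomp Require Import freeg zify.
From mathcomp Require Import all_classical all_reals topology normedtype sequences exp trigo.
Import Order.TTheory GRing.Theory Num.Theory numFieldNormedType.Exports.
Set Implicit Arguments.
Unset Strict Implicit.
Unset Printing Implicit Defensive.
Local Open Scope classical_set_scope.
Local Open Scope quotient_scope.
Local Open Scope ring_scope.

Definition std_simplex (R : realType) (n : nat) : set 'rV[R]_n.+1 :=
  [set t | (forall i, 0 <= t ord0 i) /\ \sum_i t ord0 i = 1].
Arguments std_simplex : clear implicits.

Section SimplexMap.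
Context {R : realType} (m n : nat) (theta : 'I_m.+1 -> 'I_n.+1).

(** The linear map sending the basis vector [e_i] to [e_(theta i)]. *)
Definition push_coord (t : 'rV[R]_m.+1) : 'rV[R]_n.+1 :=
  \row_j \sum_(i | theta i == j) t ord0 i.

Lemma push_coord_simplex (t : std_simplex R m) :
  push_coord (\val t) \in std_simplex R n.
Proof.
case: t => t /= /set_mem[t0 t1]; apply/mem_set; split=> [j|].
  by rewrite mxE; apply: sumr_ge0 => i _; exact: t0.
rewrite -t1 [RHS](partition_big theta predT) //=.
by apply: eq_bigr => j _; rewrite mxE.
Qed.

Definition simplex_map_fun (t : std_simplex R m) : std_simplex R n :=
  exist _ (push_coord (\val t)) (push_coord_simplex t).

Lemma push_coord_continuous : continuous push_coord.
Proof.
move=> t A [P nP sPA].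
have nQ j : nbhs t [set u | P ord0 j (\sum_(i | theta i == j) u ord0 i)].
  have ct : {for t, continuous
      (fun u : 'rV[R]_m.+1 => \sum_(i | theta i == j) u ord0 i)}.
    apply: continuous_big => [|i _]; first exact: add_continuous.
    exact: coord_continuous.
  by apply: ct; have := nP ord0 j; rewrite mxE.
have /filterS : nbhs t (fun u => forall j,
    [set u : 'rV[R]_m.+1 | P ord0 j (\sum_(i | theta i == j) u ord0 i)] u).
  exact: (@filter_forall _ _ _ (nbhs t) (nbhs_filter t) nQ).
apply => u Pu; apply: sPA => i j.
by rewrite (ord1 i) mxE; exact: Pu.
Qed.

Lemma simplex_map_continuous : continuous simplex_map_fun.
Proof.
apply: continuous_comp_initial => t.
apply: (@continuous_comp _ _ _ set_val push_coord).
  exact: initial_continuous.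
exact: push_coord_continuous.
Qed.

Definition simplex_map : continuousType (std_simplex R m) (std_simplex R n) :=
  mkcts simplex_map_continuous.

End SimplexMap.

(** [coface i] misses the vertex [i]; [codegen j] hits the vertex [j] twice. *)
Definition coface (R : realType) n (i : 'I_n.+2)
    : continuousType (std_simplex R n) (std_simplex R n.+1) :=
  simplex_map (fintype.lift i).

Definition codegen (R : realType) n (j : 'I_n.+1)
    : continuousType (std_simplex R n.+1) (std_simplex R n) :=
  simplex_map (fun k : 'I_n.+2 => inord (unbump j k)).

Record simplicialSet := SimplicialSet {
  simplex :> nat -> choiceType;
  face : forall n, 'I_n.+2 -> simplex n.+1 -> simplex n;
  degen : forall n, 'I_n.+1 -> simplex n -> simplex n.+1;
  face_face : forall n (i j : 'I_n.+3) (x : simplex n.+2), (i < j)%N ->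
    face (inord i) (face j x) = face (inord j.-1) (face i x);
  face_degen_lt : forall n (i : 'I_n.+3) (j : 'I_n.+2) (x : simplex n.+1),
    (i < j)%N ->
    face i (degen j x) = degen (inord j.-1) (face (inord i) x);
  face_degen_id : forall n (i : 'I_n.+2) (j : 'I_n.+1) (x : simplex n),
    (i == j :> nat) || (i == j.+1 :> nat) -> face i (degen j x) = x;
  face_degen_gt : forall n (i : 'I_n.+3) (j : 'I_n.+2) (x : simplex n.+1),
    (j.+1 < i)%N ->
    face i (degen j x) = degen (inord j) (face (inord i.-1) x);
  degen_degen : forall n (i j : 'I_n.+1) (x : simplex n), (i <= j)%N ->
    degen (inord i) (degen j x) = degen (inord j.+1) (degen i x)
}.

Section Realization.
Variables (R : realType) (X : simplicialSet).

Definition simplex_idx : choiceType := {n : nat & X n}.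

(** The disjoint union of one copy of the standard [n]-simplex for each
    [n]-simplex of [X]. *)
Definition pre_realization : topologicalType :=
  {x : simplex_idx & std_simplex R (projT1 x) : topologicalType}.

Definition pre_pt n (x : X n) (t : std_simplex R n) : pre_realization :=
  existT (fun x : simplex_idx => std_simplex R (projT1 x) : topologicalType)
    (existT (fun n => X n : Type) n x) t.

Inductive glue_step : pre_realization -> pre_realization -> Prop :=
| glue_face n (i : 'I_n.+2) (x : X n.+1) (t : std_simplex R n) :
    glue_step (pre_pt (face i x) t) (pre_pt x (coface R i t))
| glue_degen n (j : 'I_n.+1) (x : X n) (t : std_simplex R n.+1) :
    glue_step (pre_pt (degen j x) t) (pre_pt x (codegen R j t)).

Definition glue : rel pre_realization :=
  fun a b => `[< Relation_Operators.clos_refl_sym_trans _ glue_step a b >].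

Lemma glue_refl : reflexive glue.
Proof. by move=> a; apply/asboolP; exact: Relation_Operators.rst_refl. Qed.

Lemma glue_sym : symmetric glue.
Proof.
by move=> a b; apply/asboolP/asboolP; exact: Relation_Operators.rst_sym.
Qed.

Lemma glue_trans : transitive glue.
Proof.
move=> b a c /asboolP ab /asboolP bc; apply/asboolP.
exact: Relation_Operators.rst_trans ab bc.
Qed.

Canonical glue_equiv := EquivRel glue glue_refl glue_sym glue_trans.
Canonical glue_equiv_direct := defaultEncModRel glue.

Definition realization : topologicalType :=
  quotient_topology {eq_quot glue}.

End Realization.

Section SingularHomology.
Variables (R : realType) (T : topologicalType).

Definition singular_simplex n : choiceType :=
  continuousType (std_simplex R n) T.

Definition singular_chain n : lmodType rat := {freeg (singular_simplex n) / rat}.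

Definition singular_face n (i : 'I_n.+2) (s : singular_simplex n.+1)
    : singular_simplex n :=
  s \o coface R i.

Definition boundary n : singular_chain n.+1 -> singular_chain n :=
  fglift (fun s =>
    \sum_(i < n.+2) (-1) ^+ i *: (<< singular_face i s >> : singular_chain n)).

Definition is_cycle n : singular_chain n -> Prop :=
  if n is n'.+1 then fun c => boundary c = 0 else fun=> True.

Definition is_boundary n (c : singular_chain n) : Prop :=
  exists b : singular_chain n.+1, c = boundary b.

(** [is_betti n d]: the classes of some cycles [z_0, ..., z_(d-1)] form a basis
    of the rational vector space [H_n(T; Q)]. *)
Definition is_betti (n d : nat) : Prop :=
  exists z : 'I_d -> singular_chain n,
    (forall i, is_cycle (z i)) /\
    forall c, is_cycle c ->
      exists! a : 'rV[rat]_d, is_boundary (c - \sum_i a ord0 i *: z i).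

Definition is_euler_characteristic (chi : int) : Prop :=
  exists (N : nat) (b : nat -> nat),
    [/\ forall n, is_betti n (b n),
        forall n, (N <= n)%N -> b n = 0%N &
        chi = \sum_(n < N) (-1) ^+ n * (b n)%:Z].

(** Betti numbers, hence the Euler characteristic, are uniquely determined. *)

Lemma boundary_is_additive n : zmod_morphism (@boundary n).
Proof. exact: lift_is_additive. Qed.

HB.instance Definition _ n :=
  GRing.isZmodMorphism.Build _ _ (@boundary n) (@boundary_is_additive n).

Lemma boundary_is_scalable n : scalable (@boundary n).
Proof.
have bE (c : singular_chain n.+1) : boundary c =
    \sum_(s <- dom c) coeff s c *: boundary (<< s >> : singular_chain n.+1).
  rewrite -{1}(freeg_sumE c) raddf_sum; apply: eq_bigr => s _.
  by rewrite /= /boundary !liftU scale1r.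
move=> k c; have [->|k0] := eqVneq k 0; first by rewrite !scale0r raddf0.
rewrite !bE scaler_sumr; under eq_bigr do rewrite coeffZ -scalerA.
by apply: perm_big; apply: uniq_perm; rewrite ?uniq_dom//; exact: domZ.
Qed.

HB.instance Definition _ n :=
  GRing.isScalable.Build _ _ _ _ (@boundary n) (@boundary_is_scalable n).

Lemma is_betti_le n d e : is_betti n d -> is_betti n e -> (d <= e)%N.
Proof.
move=> [y [cy uy]] [z [cz uz]].
have /all_sig[A hA] (i : 'I_d) : {a : 'rV[rat]_e |
    is_boundary (y i - \sum_j a ord0 j *: z j)}.
  by apply: cid; have [a [ha _]] := uz _ (cy i); exists a.
pose M := \matrix_(i, j) A i ord0 j.
have bndsum (v : 'rV[rat]_d) : v *m M = 0 ->
    is_boundary (\sum_i v ord0 i *: y i).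
  move=> vM0; have /all_sig[b hb] i : {b | y i - \sum_j A i ord0 j *: z j =
      boundary b} by apply: cid; exact: hA.
  exists (\sum_i v ord0 i *: b i); rewrite linear_sum /=.
  under [RHS]eq_bigr do rewrite linearZ /= -hb scalerBr scaler_sumr.
  rewrite sumrB [X in _ = _ - X](_ : _ = 0) ?subr0 // exchange_big /=.
  apply: big1 => j _; under eq_bigr do rewrite scalerA.
  rewrite -scaler_suml; suff -> : \sum_i v ord0 i * A i ord0 j = 0.
    by rewrite scale0r.
  have /matrixP/(_ ord0 j) := vM0; rewrite mxE [RHS]mxE => vM0j.
  by rewrite -[RHS]vM0j; apply: eq_bigr => i _; rewrite mxE.
suff : row_free M by move/eqP <-; exact: rank_leq_col.
apply/inj_row_free => v /bndsum [b hb].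
have cyc0 : is_cycle (0 : singular_chain n).
  by case: (n) => //= k; rewrite raddf0.
have [a [_ ua]] := uy _ cyc0.
rewrite -(ua v) ?(ua 0)//.
  exists 0; rewrite raddf0 big1 ?subr0// => i _.
  by rewrite mxE scale0r.
by exists (- b); rewrite raddfN /= -hb sub0r.
Qed.

Lemma is_euler_characteristic_unique chi chi' :
  is_euler_characteristic chi -> is_euler_characteristic chi' -> chi = chi'.
Proof.
move=> [N [b [hb b0 ->]]] [N' [b' [hb' b'0 ->]]].
have bE n : b n = b' n by apply/eqP; rewrite eqn_leq !(@is_betti_le n).
have ext K K' (f : nat -> nat) : (forall n, (K <= n)%N -> f n = 0%N) ->
    \sum_(n < K) (-1) ^+ n * (f n)%:Z =
    \sum_(n < K + K') (-1) ^+ n * (f n)%:Z :> int.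
  move=> f0; rewrite big_split_ord /= [X in _ + X]big1 ?addr0// => i _.
  by rewrite f0 ?mulr0// leq_addr.
rewrite (ext N N' b)// (ext N' N b')// addnC.
by apply: eq_bigr => i _; rewrite bE.
Qed.

End SingularHomology.

Section E.
Variables (gT : finGroupType) (q : nat) (G : {group gT}).

Definition E_cond n (g : {ffun 'I_n.+1 -> gT}) : bool :=
  [forall i, g i \in G] &&
  ('L_q(<<[set g i | i : 'I_n.+1 & i != ord0]>>) == 1)%g.

Definition E_simplex n : choiceType := {g : {ffun 'I_n.+1 -> gT} | E_cond g}.

(** At [i = n.+1] only the first branch is ever taken. *)
Definition E_face_fun n (i : 'I_n.+2) (g : {ffun 'I_n.+2 -> gT})
    : {ffun 'I_n.+1 -> gT} :=
  [ffun k : 'I_n.+1 =>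
    if (k < i)%N then g (inord k)
    else if k == i :> nat then (g (inord k) * g (inord k.+1))%g
    else g (inord k.+1)].

Definition E_degen_fun n (j : 'I_n.+1) (g : {ffun 'I_n.+1 -> gT})
    : {ffun 'I_n.+2 -> gT} :=
  [ffun k : 'I_n.+2 =>
    if (k <= j)%N then g (inord k)
    else if k == j.+1 :> nat then 1%g
    else g (inord k.-1)].

Lemma E_cond_sub m n (g : {ffun 'I_m.+1 -> gT}) (h : {ffun 'I_n.+1 -> gT}) :
  E_cond g -> (forall k, h k \in G) ->
  (forall k, k != ord0 -> h k \in <<[set g i | i : 'I_m.+1 & i != ord0]>>)%g ->
  E_cond h.
Proof.
move=> /andP[_ Lg] hG hg; apply/andP; split; first exact/forallP.
rewrite -subG1 -(eqP Lg); apply: lcnS.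
rewrite gen_subG; apply/fintype.subsetP => x /imsetP[k].
by rewrite inE => k0 ->; exact: hg.
Qed.

Lemma E_face_cond n (i : 'I_n.+2) (g : {ffun 'I_n.+2 -> gT}) :
  E_cond g -> E_cond (E_face_fun i g).
Proof.
move=> Eg; have /andP[/forallP gG _] := Eg.
apply: (E_cond_sub Eg) => k; rewrite ffunE.
  by case: ifP => _; [|case: ifP => _]; rewrite ?groupM.
have gen j : j != ord0 ->
    g j \in <<[set g i0 | i0 : 'I_n.+2 & i0 != ord0]>>%g.
  by move=> j0; apply/mem_gen/imset_f; rewrite inE.
have in0 (j : nat) : (0 < j < n.+2)%N -> inord j != ord0 :> 'I_n.+2.
  by move=> jn; rewrite -val_eqE /= inordK; lia.
have kn := ltn_ord k; rewrite -val_eqE /= => k0.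
by case: ifP => _; [|case: ifP => _]; rewrite ?groupM// gen// in0//; lia.
Qed.

Lemma E_degen_cond n (j : 'I_n.+1) (g : {ffun 'I_n.+1 -> gT}) :
  E_cond g -> E_cond (E_degen_fun j g).
Proof.
move=> Eg; have /andP[/forallP gG _] := Eg.
apply: (E_cond_sub Eg) => k; rewrite ffunE.
  by case: ifP => _; [|case: ifP => _]; rewrite ?group1.
have gen l : l != ord0 ->
    g l \in <<[set g i0 | i0 : 'I_n.+1 & i0 != ord0]>>%g.
  by move=> l0; apply/mem_gen/imset_f; rewrite inE.
have in0 (l : nat) : (0 < l < n.+1)%N -> inord l != ord0 :> 'I_n.+1.
  by move=> ln; rewrite -val_eqE /= inordK; lia.
have kn := ltn_ord k; have jn := ltn_ord j; rewrite -val_eqE /= => k0.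
case: ifP => kj; first by rewrite gen// in0//; lia.
by case: ifP => kj'; rewrite ?group1// gen// in0//; lia.
Qed.

Definition E_face n (i : 'I_n.+2) (g : E_simplex n.+1) : E_simplex n :=
  exist _ (E_face_fun i (\val g)) (E_face_cond i (valP g)).

Definition E_degen n (j : 'I_n.+1) (g : E_simplex n) : E_simplex n.+1 :=
  exist _ (E_degen_fun j (\val g)) (E_degen_cond j (valP g)).

Lemma E_face_funE n (i : 'I_n.+2) (g : {ffun 'I_n.+2 -> gT}) k :
  (k < n.+1)%N -> E_face_fun i g (inord k) =
    if (k < i)%N then g (inord k)
    else if k == i :> nat then (g (inord k) * g (inord k.+1))%g
    else g (inord k.+1).
Proof. by move=> kn; rewrite ffunE inordK. Qed.

Lemma E_degen_funE n (j : 'I_n.+1) (g : {ffun 'I_n.+1 -> gT}) k :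
  (k < n.+2)%N -> E_degen_fun j g (inord k) =
    if (k <= j)%N then g (inord k)
    else if k == j.+1 :> nat then 1%g
    else g (inord k.-1).
Proof. by move=> kn; rewrite ffunE inordK. Qed.

Lemma E_simplex_eq n (g h : E_simplex n) :
  (forall k, (k < n.+1)%N -> \val g (inord k) = \val h (inord k)) -> g = h.
Proof.
move=> gh; apply/val_inj/ffunP => k; rewrite -(inord_val k).
exact: gh.
Qed.

Lemma E_face_face n (i j : 'I_n.+3) (x : E_simplex n.+2) : (i < j)%N ->
  E_face (inord i) (E_face j x) = E_face (inord j.-1) (E_face i x).
Proof.
move=> ij; have jn := ltn_ord j; apply: E_simplex_eq => k kn /=.
rewrite !E_face_funE ?inordK; try lia.
repeat (case: ifP => ? //; try lia); rewrite ?mulgA //.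
Qed.

Lemma E_face_degen_lt n (i : 'I_n.+3) (j : 'I_n.+2) (x : E_simplex n.+1) :
  (i < j)%N ->
  E_face i (E_degen j x) = E_degen (inord j.-1) (E_face (inord i) x).
Proof.
move=> ij; have jn := ltn_ord j; apply: E_simplex_eq => k kn /=.
rewrite E_face_funE ?E_degen_funE ?inordK; try lia.
repeat (case: ifP => ? //; try lia); rewrite ?E_face_funE ?inordK; try lia;
  repeat (case: ifP => ? //; try lia); by rewrite ?prednK //; lia.
Qed.

Lemma E_face_degen_id n (i : 'I_n.+2) (j : 'I_n.+1) (x : E_simplex n) :
  (i == j :> nat) || (i == j.+1 :> nat) -> E_face i (E_degen j x) = x.
Proof.
move=> ij; have jn := ltn_ord j; apply: E_simplex_eq => k kn /=.
rewrite !E_face_funE ?E_degen_funE ?inordK; try lia.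
by repeat (case: ifP => ? //; try lia); rewrite ?mulg1 ?mul1g.
Qed.

Lemma E_face_degen_gt n (i : 'I_n.+3) (j : 'I_n.+2) (x : E_simplex n.+1) :
  (j.+1 < i)%N ->
  E_face i (E_degen j x) = E_degen (inord j) (E_face (inord i.-1) x).
Proof.
move=> ij; have jn := ltn_ord j; have iN := ltn_ord i.
apply: E_simplex_eq => k kn /=.
rewrite E_face_funE ?E_degen_funE ?inordK; try lia.
repeat (case: ifP => ? //; try lia); rewrite ?E_face_funE ?inordK; try lia;
  repeat (case: ifP => ? //; try lia); by rewrite ?prednK //; lia.
Qed.

Lemma E_degen_degen n (i j : 'I_n.+1) (x : E_simplex n) : (i <= j)%N ->
  E_degen (inord i) (E_degen j x) = E_degen (inord j.+1) (E_degen i x).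
Proof.
move=> ij; have jn := ltn_ord j; apply: E_simplex_eq => k kn /=.
rewrite E_degen_funE // [RHS]E_degen_funE // !inordK; try lia.
repeat (case: ifP => ? //; try lia); rewrite ?E_degen_funE ?inordK; try lia;
  repeat (case: ifP => ? //; try lia); by rewrite ?prednK //; lia.
Qed.

Definition E_sset : simplicialSet :=
  SimplicialSet E_face_face E_face_degen_lt E_face_degen_id E_face_degen_gt
    E_degen_degen.

Definition E_space (R : realType) : topologicalType := realization R E_sset.

End E.

Section Mobius.
Variables (gT : finGroupType) (L : {set {group gT}}).
Implicit Types A B U : {group gT}.

Fixpoint mobius_rec (fuel : nat) A B : int :=
  if fuel is k.+1 then
    if A == B then 1
    else if A \subset B then
      - \sum_(U in L | (A \subset U) && (U \proper B)) mobius_rec k A U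
    else 0
  else 0.

(** The Moebius function of the subposet [L] of the subgroup lattice;
    [mobiusxx] and [mobius_lt] are its defining recursion. *)
Definition mobius A B : int := mobius_rec #|B|.+1 A B.

Lemma mobius_recE k l A B : (#|B| < k)%N -> (#|B| < l)%N ->
  mobius_rec k A B = mobius_rec l A B.
Proof.
elim: k l B => [//|k IH] [//|l] B Bk Bl /=.
case: ifP => // _; case: ifP => // _; congr (- _).
apply: eq_bigr => U /andP[_ /andP[_ /proper_card UB]].
by apply: IH; exact: leq_trans UB _.
Qed.

Lemma mobiusxx A : mobius A A = 1.
Proof. by rewrite /mobius /= eqxx. Qed.

Lemma mobius_lt A B : A \proper B ->
  mobius A B = - \sum_(U in L | (A \subset U) && (U \proper B)) mobius A U.
Proof.
move=> AB; rewrite {1}/mobius /= (proper_sub AB).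
case: eqP => [AeB|_]; first by rewrite AeB fintype.properxx in AB.
congr (- _); apply: eq_bigr => U /andP[_ /andP[_ /proper_card UB]].
exact: mobius_recE.
Qed.

End Mobius.

Section Pq.
Variables (gT : finGroupType) (q : nat) (G : {group gT}).

Definition Nq : {set {group gT}} :=
  [set H : {group gT} | (H \proper G) && ('L_q(H) == 1)%g].

Definition Lq : {set {group gT}} := G |: Nq.

(** [k ^ s = exp (s * ln k)] for a positive integer [k] and complex [s]. *)
Definition nat_cpow (R : realType) (k : nat) (s : R[i]) : R[i] :=
  let u := complex.Re s * ln k%:R in
  let v := complex.Im s * ln k%:R in
  (expR u * cos v +i* (expR u * sin v))%C.

Lemma nat_cpow1 (R : realType) k : (0 < k)%N -> nat_cpow k (1 : R[i]) = k%:R.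
Proof.
move=> k0; rewrite /nat_cpow /= mul1r mul0r cos0 sin0 mulr1 mulr0.
by rewrite lnK ?posrE ?ltr0n// -(rmorph_nat (real_complex R)).
Qed.

Definition Pq (R : realType) (s : R[i]) : R[i] :=
  - \sum_(A in Nq) (mobius Lq A G)%:~R * nat_cpow #|G : A|%g (- s).

End Pq.

(* Main.v *)
Require Import Defs.
From HB Require Import structures.
From mathcomp Require Import all_boot ssrAC all_order all_algebra all_fingroup all_solvable.
From mathcomp Require Import zify ring lra.
From mathcomp Require Import freeg generic_quotient.
From mathcomp Require Import complex all_classical all_reals topology normedtype sequences.
Import Order.TTheory GRing.Theory Num.Theory numFieldNormedType.Exports.
Set Implicit Arguments.
Unset Strict Implicit.
Unset Printing Implicit Defensive.
Local Open Scope classical_set_scope.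
Local Open Scope quotient_scope.
Local Open Scope ring_scope.

(** An n-simplex (g_0, ..., g_n) of [E_sset q G] is determined by its vertices
    x_i = g_0 g_1 ... g_i, and the tuples (x_0, ..., x_n) that occur are those
    contained in one left coset of a subgroup [H] of [G] with ['L_q(H) = 1]; faces
    delete and degeneracies repeat a vertex.  So [E_space q G R] is a fattened form
    of the simplicial complex on the vertex set [G] whose simplices are the
    nonempty sets [S] with [in_coset q G S], and its Euler characteristic is
    expected to be the alternating count of these sets.

    Instead of comparing the two spaces, the count is read off from a good cover.
    The barycentric coordinates [coord a], [a] in [G], are continuous functions on
    the realization, and the open stars [star a] where they are positive cover it.
    For a nonempty set [S] of vertices, the intersection of the stars of its
    elements is empty unless [in_coset q G S]; in that case it is contractible,
    because every simplex meeting it can be joined with [S] inside the same coset,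
    and a point slides along the join to the barycenter of [S]
    ([star_contracts]).  Continuity of this homotopy on a quotient space is a tube
    argument ([quotient_homotopy_continuous]).

    The passage from the cover to the Euler characteristic of singular homology,
    [nerve_euler_characteristic], rests on three facts.
    - Chains whose simplices each lie in a contractible set have the homology of a
      point, since coning off is a chain contraction ([has_euler_contractible]).
    - For subcomplexes [A] and [B], the Mayer-Vietoris sequence makes the Euler
      characteristic additive: that of [A + B] is the sum of those of [A] and [B]
      minus that of the intersection ([has_euler_join]).  Applied to families of
      singular simplices it gives inclusion-exclusion over the cover, with no
      topology involved ([has_euler_covered]).
    - Chains subordinate to the cover compute the whole homology: barycentric
      subdivision is chain homotopic to the identity ([bd_sd_htpy]) and multiplies
      diameters by at most n / (n + 1) ([sd_model_shrinks]), so that a Lebesgue number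
      makes some iterate of it subordinate ([has_euler_is_euler]).

    It remains to evaluate the alternating sum over the sets [S] contained in a
    coset.  Such an [S] is contained in a coset of [A] exactly when [A] contains the
    subgroup [spread S] generated by the quotients of its elements, and the values
    [mobius A G] over the members [A] of [Nq q G] above a given one add up to -1
    (this is the Moebius recursion in the other variable, [mobius_dual_sum]).
    Exchanging the two summations leaves, for each [A], one contribution from each
    of its cosets, which is the coefficient of the Dirichlet series at s = -1
    ([sum_subsets_in_coset]). *)

(** * Chains over a free module *)

Section Chains.
Variables (K : choiceType) (M : lmodType rat).

Definition extend (f : K -> M) (c : {freeg K / rat}) : M := fglift f c.

Lemma extendE f c : extend f c = \sum_(x <- dom c) coeff x c *: f x.
Proof.
rewrite /extend -{1}(freeg_sumE c).
have add : zmod_morphism (fglift f) by exact: lift_is_additive.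
pose h := GRing.isZmodMorphism.Build _ _ (fglift f) add.
pose hh : {additive {freeg K / rat} -> M} := HB.pack (fglift f) h.
rewrite -[fglift f]/(hh : _ -> _) raddf_sum; apply: eq_bigr => x _ /=.
by rewrite liftU.
Qed.

Lemma extend_is_zmod_morphism f : zmod_morphism (extend f).
Proof. exact: lift_is_additive. Qed.

HB.instance Definition _ f :=
  GRing.isZmodMorphism.Build _ _ (extend f) (extend_is_zmod_morphism f).

Lemma extend_is_scalable f : scalable (extend f).
Proof.
move=> k c; have [->|k0] := eqVneq k 0; first by rewrite !scale0r raddf0.
rewrite !extendE scaler_sumr; under eq_bigr do rewrite coeffZ -scalerA.
by apply: perm_big; apply: uniq_perm; rewrite ?uniq_dom//; exact: domZ.
Qed.

HB.instance Definition _ f :=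
  GRing.isScalable.Build _ _ _ _ (extend f) (extend_is_scalable f).

Lemma extendU f x : extend f << x >> = f x.
Proof. by rewrite /extend liftU scale1r. Qed.

(** Carrying a predicate on the generators, rather than the submodule they span,
    lets every later closure property be checked on a single simplex. *)
Definition supp (P : K -> Prop) (c : {freeg K / rat}) : Prop :=
  forall x, x \in dom c -> P x.

Lemma chain_sum (c : {freeg K / rat}) :
  c = \sum_(x <- dom c) coeff x c *: << x >>.
Proof.
rewrite -{1}(freeg_sumE c); apply: eq_bigr => x _.
by apply/eqP/freeg_eqP => y; rewrite coeffZ !coeffU mul1r.
Qed.

Lemma supp_linear_eq (P : K -> Prop) (f g : {linear {freeg K / rat} -> M}) c :
  supp P c -> (forall x, P x -> f << x >> = g << x >>) -> f c = g c.
Proof.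
move=> Pc fg; rewrite (chain_sum c) !linear_sum big_seq [RHS]big_seq.
by apply: eq_bigr => x /Pc Px; rewrite !linearZ fg.
Qed.

Lemma linear_chain_eq (f g : {linear {freeg K / rat} -> M}) :
  (forall x, f << x >> = g << x >>) -> f =1 g.
Proof. by move=> fg c; apply: (@supp_linear_eq (fun=> True)) => // x _. Qed.

End Chains.

Section Support.
Variables (K : choiceType).
Implicit Types (P Q : K -> Prop) (c : {freeg K / rat}).

Lemma supp0 P : supp P 0. Proof. by move=> x; rewrite dom0. Qed.

Lemma suppU P x : P x -> supp P << x >>.
Proof. by move=> Px y; rewrite domU1 mem_seq1 => /eqP ->. Qed.

Lemma suppD P c c' : supp P c -> supp P c' -> supp P (c + c').
Proof.
by move=> Pc Pc' x /domD_subset; rewrite mem_cat => /orP[/Pc|/Pc'].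
Qed.

Lemma suppZ P a c : supp P c -> supp P (a *: c).
Proof. by move=> Pc x /domZ_subset; exact: Pc. Qed.

Lemma suppN P c : supp P c -> supp P (- c).
Proof. by rewrite -scaleN1r; exact: suppZ. Qed.

Lemma suppB P c c' : supp P c -> supp P c' -> supp P (c - c').
Proof. by move=> Pc Pc'; apply: suppD => //; exact: suppN. Qed.

Lemma supp_sum P I (r : seq I) (p : pred I) (F : I -> {freeg K / rat}) :
  (forall i, p i -> supp P (F i)) -> supp P (\sum_(i <- r | p i) F i).
Proof.
move=> PF; elim/big_rec: _ => [|i c pi Pc]; first exact: supp0.
exact: suppD (PF i pi) Pc.
Qed.

Lemma supp_mono P Q c : (forall x, P x -> Q x) -> supp P c -> supp Q c.
Proof. by move=> PQ Pc x /Pc/PQ. Qed.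

Lemma supp_or P Q c : supp (fun x => P x \/ Q x) c ->
  exists a b, [/\ supp P a, supp Q b & c = a + b].
Proof.
move=> PQc; pose r b := \sum_(x <- dom c | `[< P x >] == b) coeff x c *: << x >>.
exists (r true), (r false); split; last 1 first.
- rewrite {1}(chain_sum c) (bigID (fun x => `[< P x >] == true)) /=; congr (_ + _).
  by apply: eq_bigl => x; case: asboolP.
- by apply: supp_sum => x /eqP/asboolP Px; exact: suppZ (suppU Px).
- rewrite /r big_seq_cond; apply: supp_sum => x /andP[xc /eqP nPx].
  have Qx : Q x by case: (PQc _ xc) => // /asboolP; rewrite nPx.
  exact: suppZ (suppU Qx).
Qed.

End Support.

Lemma supp_extend (K L : choiceType) (P : K -> Prop) (Q : L -> Prop) (f : K -> {freeg L / rat}) c :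
  (forall x, P x -> supp Q (f x)) -> supp P c -> supp Q (extend f c).
Proof.
move=> PQ Pc; rewrite extendE big_seq; apply: supp_sum => x /Pc Px.
exact: suppZ (PQ x Px).
Qed.

(** * Mayer-Vietoris for Euler characteristics *)

Section LinComb.
Variables (V : lmodType rat) (k : nat) (z : 'I_k -> V).

Definition lincomb (a : 'rV[rat]_k) : V := \sum_i a ord0 i *: z i.

Lemma lincomb_is_linear : linear lincomb.
Proof.
move=> x a b; rewrite /lincomb scaler_sumr -big_split /=; apply: eq_bigr => i _.
by rewrite !mxE scalerDl scalerA.
Qed.

HB.instance Definition _ :=
  GRing.isLinear.Build _ _ _ _ lincomb lincomb_is_linear.

Lemma lincomb_mul m (W : 'M[rat]_(m, k)) a :
  lincomb (a *m W) = \sum_i a ord0 i *: lincomb (row i W).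
Proof.
rewrite /lincomb; under [RHS]eq_bigr do rewrite scaler_sumr.
rewrite exchange_big /=; apply: eq_bigr => j _; rewrite mxE scaler_suml.
by apply: eq_bigr => i _; rewrite scalerA mxE.
Qed.

End LinComb.

Section HomologyBasis.
Variables (X Y Z : lmodType rat) (d1 : {linear X -> Y}) (d0 : {linear Y -> Z}).

(** The three-term form [X -> Y -> Z] keeps degree 0 from being a special case: there
    [Z] is taken to be the zero space. *)
Definition homology_basis (CX : X -> Prop) (CY : Y -> Prop) k (z : 'I_k -> Y) :=
  (forall i, CY (z i) /\ d0 (z i) = 0) /\
  forall c, CY c -> d0 c = 0 ->
    exists! a, exists2 b, CX b & c - lincomb z a = d1 b.

End HomologyBasis.

Definition submodule (V : lmodType rat) (C : V -> Prop) :=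
  C 0 /\ forall a u v, C u -> C v -> C (a *: u + v).

Section Submodule.
Variables (V : lmodType rat) (C : V -> Prop).
Hypothesis sC : submodule C.

Lemma submodule0 : C 0. Proof. by case: sC. Qed.

Lemma submoduleZD a u v : C u -> C v -> C (a *: u + v).
Proof. by case: sC => _; apply. Qed.

Lemma submoduleD u v : C u -> C v -> C (u + v).
Proof. by move=> *; rewrite -[u]scale1r; exact: submoduleZD. Qed.

Lemma submoduleZ a u : C u -> C (a *: u).
Proof.
by move=> Cu; rewrite -[_ *: _]addr0; apply: submoduleZD => //; exact: submodule0.
Qed.

Lemma submoduleN u : C u -> C (- u).
Proof. by rewrite -scaleN1r; exact: submoduleZ. Qed.

Lemma submoduleB u v : C u -> C v -> C (u - v).
Proof. by move=> Cu Cv; apply: submoduleD => //; exact: submoduleN. Qed.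

Lemma submodule_sum I (r : seq I) (P : pred I) (F : I -> V) :
  (forall i, P i -> C (F i)) -> C (\sum_(i <- r | P i) F i).
Proof.
move=> CF; elim/big_rec: _ => [|i c Pi Cc]; first exact: submodule0.
by apply: submoduleD => //; exact: CF.
Qed.

Lemma submodule_lincomb k (z : 'I_k -> V) a : (forall i, C (z i)) -> C (lincomb z a).
Proof. by move=> Cz; apply: submodule_sum => i _; exact: submoduleZ. Qed.

End Submodule.

Definition fam_cat (V : Type) k l (z : 'I_k -> V) (y : 'I_l -> V) (j : 'I_(k + l)) : V :=
  match fintype.split j with inl i => z i | inr i => y i end.

Lemma fam_catP (V : Type) k l (z : 'I_k -> V) (y : 'I_l -> V) (P : V -> Prop) :
  (forall i, P (z i)) -> (forall i, P (y i)) -> forall j, P (fam_cat z y j).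
Proof. by move=> Pz Py j; rewrite /fam_cat; case: fintype.split. Qed.

Lemma lincomb_fam_cat (V : lmodType rat) k l (z : 'I_k -> V) (y : 'I_l -> V) v :
  lincomb (fam_cat z y) v = lincomb z (lsubmx v) + lincomb y (rsubmx v).
Proof.
rewrite /lincomb big_split_ord /=; congr (_ + _); apply: eq_bigr => i _;
  rewrite mxE; congr (_ *: _); rewrite /fam_cat.
  by rewrite (unsplitK (inl i)).
by rewrite (unsplitK (inr i)).
Qed.

(** The bookkeeping in the spanning half of [mv_basis]: the right-hand side gathers
    what bounds, and the terms [y] and [J] cancel. *)
Lemma mayer_vietoris_rearrange (V : zmodType) (s t P Q U W L B y J : V) :
  s + t - (P + Q - (U - W) + (L - B)) =
  (s - L - y - P) - (J - U) + ((t + B + y - Q) + (J - W)).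
Proof.
rewrite !opprD !opprK !addrA.
by rewrite [RHS](ACl (1*7*4*10*6*12*2*8*(3*9)*(5*11))) /= !addNr !addr0.
Qed.

(** One degree of the Mayer-Vietoris sequence of the complexes [A] and [B].  The
    families [yI], [yA], [yB] are bases of the homology of the intersection, of [A]
    and of [B] at [Y]; the matrix [M] is the map x |-> (x, -x) from the first homology
    to the sum of the other two.  The family [zI] and the matrix [N] are the
    corresponding data one degree below, known only through the boundaries there. *)
Section MayerVietoris.
Variables (X Y Z : lmodType rat) (d1 : {linear X -> Y}) (d0 : {linear Y -> Z}).
Hypothesis d0d1 : forall x, d0 (d1 x) = 0.
Variables (AX BX : X -> Prop) (AY BY : Y -> Prop).
Hypotheses (sAX : submodule AX) (sBX : submodule BX).
Hypotheses (sAY : submodule AY) (sBY : submodule BY).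
Hypotheses (d1A : forall x, AX x -> AY (d1 x)) (d1B : forall x, BX x -> BY (d1 x)).

Definition pred_meet (V : Type) (A B : V -> Prop) (v : V) := A v /\ B v.
Definition pred_join (V : lmodType rat) (A B : V -> Prop) (v : V) :=
  exists a b, [/\ A a, B b & v = a + b].

Variables (k l i a b : nat).
Variables (zI : 'I_k -> Z) (N : 'M[rat]_(k, l)).
Variables (yI : 'I_i -> Y) (yA : 'I_a -> Y) (yB : 'I_b -> Y).
Variables (MA : 'M[rat]_(i, a)) (MB : 'M[rat]_(i, b)).

Hypothesis zI_span : forall s t, AY s -> BY t -> d0 s = - d0 t ->
  exists u, exists2 y, AY y /\ BY y & d0 s - lincomb zI u = d0 y.
Hypothesis zI_free : forall u y, AY y -> BY y -> lincomb zI u = d0 y -> u = 0.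
Hypothesis zI_ker : forall u, u *m N = 0 <->
  exists s t, [/\ AY s, BY t, d0 s = lincomb zI u & d0 t = lincomb zI u].
Hypothesis yI_basis : homology_basis d1 d0 (pred_meet AX BX) (pred_meet AY BY) yI.
Hypothesis yA_basis : homology_basis d1 d0 AX AY yA.
Hypothesis yB_basis : homology_basis d1 d0 BX BY yB.
Hypothesis yI_A : forall j, exists2 x, AX x & yI j - lincomb yA (row j MA) = d1 x.
Hypothesis yI_B : forall j, exists2 x, BX x & yI j - lincomb yB (row j MB) = d1 x.

Let M := row_mx MA (- MB).

Lemma cycle_lincomb n (z : 'I_n -> Y) u : (forall j, d0 (z j) = 0) -> d0 (lincomb z u) = 0.
Proof.
move=> z0; rewrite /lincomb linear_sum /= big1 // => j _.
by rewrite linearZ /= z0 scaler0.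
Qed.

(** The matrix [W] of a map on homology, given on basis elements, describes it on all
    linear combinations. *)
Lemma homology_transfer (CX : X -> Prop) n (z : 'I_n -> Y) (W : 'M_(i, n)) : submodule CX ->
  (forall j, exists2 x, CX x & yI j - lincomb z (row j W) = d1 x) ->
  forall u, exists2 x, CX x & lincomb yI u - lincomb z (u *m W) = d1 x.
Proof.
move=> sC ex u.
have H j : {x | CX x & yI j - lincomb z (row j W) = d1 x} by apply: cid2; exact: ex.
exists (lincomb (fun j => s2val (H j)) u).
  by apply: submodule_lincomb => // j; case: (H j).
rewrite lincomb_mul -sumrB linear_sum; apply: eq_bigr => j _ /=.
by rewrite -scalerBr linearZ /= -(s2valP' (H j)).
Qed.

Lemma homology_basis_free (CX : X -> Prop) (CY : Y -> Prop) n (z : 'I_n -> Y) u x :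
  submodule CX -> submodule CY -> homology_basis d1 d0 CX CY z ->
  CX x -> lincomb z u = d1 x -> u = 0.
Proof.
move=> sX sY [cz uz] Cx zx.
have [v [_ uniq]] := uz 0 (submodule0 sY) (linear0 _).
transitivity v; first apply/esym.
  by apply: uniq; exists (- x); [exact: submoduleN | rewrite zx sub0r linearN].
by apply: uniq; exists 0; [exact: submodule0 | rewrite linear0 subr0 linear0].
Qed.

Lemma homology_basisI (CX : X -> Prop) (CY : Y -> Prop) n (z : 'I_n -> Y) :
  submodule CX ->
  (forall j, CY (z j)) -> (forall j, d0 (z j) = 0) ->
  (forall c, CY c -> d0 c = 0 -> exists u, exists2 x, CX x & c - lincomb z u = d1 x) ->
  (forall u x, CX x -> lincomb z u = d1 x -> u = 0) ->
  homology_basis d1 d0 CX CY z.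
Proof.
move=> sX Cz cz span free; split=> // c Cc c0.
have [u [x Cx ux]] := span _ Cc c0; exists u; split; first by exists x.
move=> u' [x' Cx' ux']; apply/eqP; rewrite -subr_eq0; apply/eqP.
apply: (free _ (x' - x)); first exact: submoduleB.
by rewrite !linearB /= -ux -ux' opprB [RHS]addrC addrA subrK.
Qed.

(** Exactness in the form of a basis: the homology of [A + B] is the cokernel of [M]
    plus the kernel of [N].  Basis elements of the first kind are combinations of [yA]
    and [yB]; one of the second kind comes from a cycle of the intersection that
    bounds both [al] in [A] and [be] in [B], and is the cycle [al - be]. *)
Lemma mv_basis : exists z : 'I_(\rank (M^C)%MS + \rank (kermx N)) -> Y,
  homology_basis d1 d0 (pred_join AX BX) (pred_join AY BY) z.
Proof.
have [[cI spI] [cA spA] [cB spB]] := And3 yI_basis yA_basis yB_basis.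
pose W := row_base (M^C)%MS; pose K := row_base (kermx N).
have KN j : row j K *m N = 0.
  by apply/sub_kermxP; rewrite (submx_trans (row_sub _ _)) // eq_row_base.
have liftK j : {st : Y * Y | [/\ AY st.1, BY st.2,
    d0 st.1 = lincomb zI (row j K) & d0 st.2 = lincomb zI (row j K)]}.
  by apply: cid; have /zI_ker [s [t [? ? ? ?]]] := KN j; exists (s, t).
pose al j := (sval (liftK j)).1; pose be j := (sval (liftK j)).2.
have alA j : AY (al j) by rewrite /al; case: (liftK j) => ? [].
have beB j : BY (be j) by rewrite /be; case: (liftK j) => ? [].
have d0al j : d0 (al j) = lincomb zI (row j K) by rewrite /al; case: (liftK j) => ? [].
have d0be j : d0 (be j) = lincomb zI (row j K) by rewrite /be; case: (liftK j) => ? [].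
pose yS := fam_cat yA yB.
pose ell j := al j - be j.
have cS u : d0 (lincomb yS u) = 0.
  apply: cycle_lincomb; apply: (@fam_catP _ _ _ yA yB (fun y => d0 y = 0)) => j.
    by case: (cA j).
  by case: (cB j).
have d0al_lin u : d0 (lincomb al u) = lincomb zI (u *m K).
  rewrite lincomb_mul linear_sum; apply: eq_bigr => j _ /=.
  by rewrite linearZ /= d0al.
have d0be_lin u : d0 (lincomb be u) = lincomb zI (u *m K).
  rewrite lincomb_mul linear_sum; apply: eq_bigr => j _ /=.
  by rewrite linearZ /= d0be.
have ellE u : lincomb ell u = lincomb al u - lincomb be u.
  by rewrite /lincomb -sumrB; apply: eq_bigr => j _; rewrite scalerBr.
have AYl u : AY (lincomb yA u).
  by apply: submodule_lincomb => // j; case: (cA j).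
have BYl u : BY (lincomb yB u).
  by apply: submodule_lincomb => // j; case: (cB j).
have AYal u : AY (lincomb al u) by exact: submodule_lincomb.
have BYbe u : BY (lincomb be u) by exact: submodule_lincomb.
have trA := homology_transfer sAX yI_A; have trB := homology_transfer sBX yI_B.
pose z := fam_cat (fun j => lincomb yS (row j W)) ell.
have zE w : lincomb z w = lincomb yS (lsubmx w *m W) + lincomb ell (rsubmx w).
  by rewrite lincomb_fam_cat lincomb_mul.
have ySE v : lincomb yS v = lincomb yA (lsubmx v) + lincomb yB (rsubmx v).
  exact: lincomb_fam_cat.
have sSX : submodule (pred_join AX BX).
  split=> [|c u v [u1 [u2 [? ? ->]]] [v1 [v2 [? ? ->]]]].
    by exists 0, 0; rewrite addr0; split=> //; exact: submodule0.
  exists (c *: u1 + v1), (c *: u2 + v2); split; try exact: submoduleZD.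
  by rewrite scalerDr addrACA.
exists z; apply: homology_basisI => //.
- apply: (fam_catP (P := pred_join AY BY)) => j.
    rewrite ySE; exists (lincomb yA (lsubmx (row j W))), (lincomb yB (rsubmx (row j W))).
    by split.
  by exists (al j), (- be j); split=> //; exact: submoduleN.
- apply: (fam_catP (P := fun y => d0 y = 0)) => j; first exact: cS.
  by rewrite linearB /= d0al d0be subrr.
  (* Spanning: the boundary of the [A]-part of a cycle lies in the intersection,
     which determines the kernel component [kap]; what remains splits into a cycle of
     [A] and a cycle of [B]. *)
- move=> c [s [t [As Bt ->]]]; rewrite linearD => /eqP; rewrite addr_eq0 => /eqP st.
  have [u [y [Ay By] sy]] := zI_span As Bt st.
  have /sub_kermxP : u *m N = 0.
    apply/zI_ker; exists (s - y), (- t - y); split; [exact: submoduleB| | |].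
    - by apply: submoduleB => //; exact: submoduleN.
    - by rewrite linearB /= -sy opprB addrC subrK.
    - by rewrite linearB linearN /= -st -sy opprB addrC subrK.
  rewrite -(eq_row_base (kermx N)) => /submxP[kap uE].
  have As' : AY (s - lincomb al kap - y) by do 2![apply: submoduleB => //].
  have Bt' : BY (t + lincomb be kap + y) by do 2![apply: submoduleD => //].
  have /(spA _ As')[p [[x1 Ax1 px1] _]] : d0 (s - lincomb al kap - y) = 0.
    by rewrite !linearB /= d0al_lin -uE -sy subrr.
  have /(spB _ Bt')[q [[x2 Bx2 qx2] _]] : d0 (t + lincomb be kap + y) = 0.
    by rewrite !linearD /= d0be_lin -uE -sy -addrA [X in _ + X]addrC subrK st subrr.
  have : (row_mx p q <= M + M^C)%MS by rewrite (submx_full _ (addsmx_compl_full M)).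
  rewrite (adds_eqmx (eqmx_refl M) (eqmx_sym (eq_row_base (M^C)%MS))).
  case/sub_addsmxP=> -[u' w'] /= pqE.
  have [xA AxA xAE] := trA u'; have [xB BxB xBE] := trB u'.
  exists (row_mx w' kap); exists ((x1 - xA) + (x2 + xB)).
    by exists (x1 - xA), (x2 + xB); split=> //; [exact: submoduleB|exact: submoduleD].
  rewrite zE row_mxKl row_mxKr ellE.
  have : lincomb yS (row_mx p q) = lincomb yS (u' *m M) + lincomb yS (w' *m W).
    by rewrite pqE linearD.
  rewrite {1 2}/M mul_mx_row [X in X = _]ySE [X in _ = X + _]ySE !row_mxKl !row_mxKr.
  rewrite mulmxN linearN /= => /eqP; rewrite [X in _ == X]addrC -subr_eq => /eqP <-.
  rewrite (linearD d1) (linearB d1) (linearD d1) -px1 -qx2 -xAE -xBE; exact: mayer_vietoris_rearrange.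
  (* Freeness: if a combination bounds [x1 + x2], its [A]-part corrected by [d1 x1] is
     the opposite of its corrected [B]-part, hence a chain [y] of the intersection. *)
- move=> w x [x1 [x2 [Ax1 Bx2 ->]]]; rewrite zE ySE ellE linearD.
  set p := lsubmx (lsubmx w *m W); set q := rsubmx (lsubmx w *m W); set kap := rsubmx w => E.
  pose y := lincomb yA p + lincomb al kap - d1 x1.
  have yE : y = - (lincomb yB q - lincomb be kap - d1 x2).
    apply/eqP; rewrite -addr_eq0 addrACA [X in X + _]addrACA E.
    by rewrite -opprD subrr.
  have Ay : AY y by apply: submoduleB; [|apply: submoduleD|exact: d1A].
  have By : BY y.
    rewrite yE; apply: submoduleN => //; apply: submoduleB; [|apply: submoduleB|exact: d1B] => //.
  have kap0 : kap = 0.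
    have dy : lincomb zI (kap *m K) = d0 y.
      rewrite linearB linearD /= d0d1 subr0 -d0al_lin.
      by rewrite (cycle_lincomb _ (fun j => (cA j).2)) add0r.
    have /eqP := zI_free Ay By dy.
    by rewrite mulmx_free_eq0 ?row_base_free // => /eqP.
  have yA' : y = lincomb yA p - d1 x1 by rewrite /y kap0 (linear0 (lincomb al)) addr0.
  have yB' : y = - (lincomb yB q - d1 x2).
    by rewrite yE kap0 (linear0 (lincomb be)) subr0.
  have dy0 : d0 y = 0.
    by rewrite yA' linearB /= d0d1 subr0 (cycle_lincomb _ (fun j => (cA j).2)).
  have [u [[x0 [Ax0 Bx0] ux0] _]] := spI y (conj Ay By) dy0.
  have [xA AxA xAE] := trA u; have [xB BxB xBE] := trB u.
  have pE : p - u *m MA = 0.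
    apply: (@homology_basis_free AX AY _ yA _ (x1 + (x0 + xA))) => //.
      by do 2![apply: submoduleD => //].
    rewrite linearB !linearD /= -ux0 -xAE subrKA addrA; congr (_ - _).
    by rewrite yA' addrC subrK.
  have qE : q + u *m MB = 0.
    apply: (@homology_basis_free BX BY _ yB _ (x2 - (x0 + xB))) => //.
      by apply: submoduleB => //; apply: submoduleD.
    rewrite (linearD (lincomb yB)) (linearB d1) (linearD d1) -ux0 -xBE subrKA opprB addrA [RHS]addrAC.
    by congr (_ + _); rewrite yB' opprK addrC subrK.
  have wM : lsubmx w *m W = u *m M.
    rewrite -[LHS]hsubmxK -/p -/q /M mul_mx_row mulmxN.
    by rewrite -(subr0_eq pE) -(addr0_eq qE) opprK.
  have : (lsubmx w *m W <= M :&: M^C)%MS.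
    rewrite sub_capmx {1}wM submxMl /=.
    by rewrite (submx_trans (submxMl _ _)) // eq_row_base.
  rewrite capmx_compl submx0 mulmx_free_eq0 ?row_base_free //.
  by move=> /eqP l0; rewrite -[w]hsubmxK -/kap kap0 l0 row_mx0.
Qed.
End MayerVietoris.

Section Complexes.
Variables (V : nat -> lmodType rat) (d : forall n, {linear V n.+1 -> V n}).
Hypothesis dd : forall n c, d n (d n.+1 c) = 0.

Definition graded_pred := forall n, V n -> Prop.
Implicit Types (A B C : graded_pred).

(** The target of the boundary in degree [n], padded by zero in degree -1. *)
Definition below (n : nat) : lmodType rat := if n is m.+1 then V m else 'rV[rat]_0.

Lemma below0_eq (x y : below 0) : x = y.
Proof. by rewrite [LHS](@thinmx0 _ 1 x) [RHS](@thinmx0 _ 1 y). Qed.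

Definition dbelow n : {linear V n -> below n} :=
  match n with
  | 0 => \0 : {linear V 0 -> 'rV[rat]_0}
  | m.+1 => d m
  end.

Lemma dbelow_d n c : dbelow n (d n c) = 0.
Proof. by case: n c => [|n] c //=; exact: dd. Qed.

Definition subcomplex C :=
  (forall n, submodule (C n)) /\ forall n c, C n.+1 c -> C n (d n c).

Definition has_betti C n k :=
  exists z : 'I_k -> V n, homology_basis (d n) (dbelow n) (C n.+1) (C n) z.

Definition has_euler C (chi : int) :=
  exists (N : nat) (b : nat -> nat),
    [/\ forall n, has_betti C n (b n), forall n, (N <= n)%N -> b n = 0%N &
        chi = \sum_(n < N) (-1) ^+ n * (b n)%:Z].

Lemma subcomplex_meet A B : subcomplex A -> subcomplex B ->
  subcomplex (fun n => pred_meet (A n) (B n)).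
Proof.
move=> [sA dA] [sB dB]; split=> [n|n c [Ac Bc]]; last by split; [exact: dA|exact: dB].
split=> [|k u v [? ?] [? ?]]; first by split; exact: submodule0.
by split; exact: submoduleZD.
Qed.

Section MayerVietorisEuler.
Variables (A B : graded_pred).
Arguments A : clear implicits.
Arguments B : clear implicits.
Hypotheses (cA : subcomplex A) (cB : subcomplex B).
Let I : graded_pred := fun n => pred_meet (A n) (B n).
Arguments I : clear implicits.
Variables (i a b : nat -> nat).
Variables (zI : forall n, 'I_(i n) -> V n) (zA : forall n, 'I_(a n) -> V n).
Variable (zB : forall n, 'I_(b n) -> V n).
Hypothesis bI : forall n, homology_basis (d n) (dbelow n) (I n.+1) (I n) (@zI n).
Hypothesis bA : forall n, homology_basis (d n) (dbelow n) (A n.+1) (A n) (@zA n).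
Hypothesis bB : forall n, homology_basis (d n) (dbelow n) (B n.+1) (B n) (@zB n).

(** The map induced in homology by an inclusion, in terms of the chosen bases. *)
Lemma inclusion_matrix C c (z : forall n, 'I_(c n) -> V n) n :
  (forall v, I n v -> C n v) ->
  homology_basis (d n) (dbelow n) (C n.+1) (C n) (@z n) ->
  exists W : 'M[rat]_(i n, c n), forall j,
    exists2 x, C n.+1 x & zI j - lincomb (@z n) (row j W) = d n x.
Proof.
move=> IC [_ span].
have ex j : {u | exists2 x, C n.+1 x & zI j - lincomb (@z n) u = d n x}.
  apply: cid; have [cz _] := bI n.
  by have [u [hu _]] := span _ (IC _ (cz j).1) (cz j).2; exists u.
exists (\matrix_j sval (ex j)) => j; rewrite rowK; exact: svalP (ex j).
Qed.

(** Here [r n] is the rank of the map from the homology of the intersection to that of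
    the two complexes. *)
Lemma mayer_vietoris_betti : exists r : nat -> nat, (forall n, r n <= i n)%N /\
  forall n, (r n <= a n + b n)%N /\
  has_betti (fun n => pred_join (A n) (B n)) n
    ((a n + b n - r n) + (if n is m.+1 then i m - r m else 0))%N.
Proof.
have [[sA dA] [sB dB]] := (cA, cB).
have sI n : submodule (I n) by exact: (subcomplex_meet cA cB).1.
have exA n : {W : 'M[rat]_(i n, a n) | forall j,
    exists2 x, A n.+1 x & zI j - lincomb (@zA n) (row j W) = d n x}.
  by apply: cid; apply: inclusion_matrix (bA n) => v [].
have exB n : {W : 'M[rat]_(i n, b n) | forall j,
    exists2 x, B n.+1 x & zI j - lincomb (@zB n) (row j W) = d n x}.
  by apply: cid; apply: inclusion_matrix (bB n) => v [].
pose MA n := sval (exA n); pose MB n := sval (exB n).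
have MAP n := svalP (exA n); have MBP n := svalP (exB n).
pose M n := row_mx (MA n) (- MB n).
exists (fun n => \rank (M n)); split=> n; first exact: rank_leq_row.
split; first exact: rank_leq_col.

suff [k [l [N [kN H]]]] : exists k l (N : 'M[rat]_(k, l)),
    \rank (kermx N) = (if n is m.+1 then i m - \rank (M m) else 0)%N /\
    exists z : 'I_(\rank ((M n)^C)%MS + \rank (kermx N)) -> V n,
    homology_basis (d n) (dbelow n) (pred_join (A n.+1) (B n.+1)) (pred_join (A n) (B n)) z.
  by rewrite /has_betti -kN -mxrank_compl.
case: n => [|n].
  exists 0%N, 0%N, 0; split; first by rewrite mxrank_ker mxrank0.
  apply: (@mv_basis _ _ _ _ _ (@dbelow_d 0) _ _ _ _ (sA 1%N) (sB 1%N) (sA 0%N) (sB 0%N)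
    (dA 0%N) (dB 0%N) _ _ _ _ _ (fun=> 0) _ (@zI 0) (@zA 0) (@zB 0) (MA 0%N) (MB 0%N)) => //.
  - move=> s t _ _ _; exists 0; exists 0; last exact: below0_eq.
    by split; exact: submodule0.
  - by move=> u *; exact: thinmx0.
  - move=> u; split=> _; last by rewrite mulmx0.
    exists 0, 0; split; [exact: submodule0|exact: submodule0| |];
      exact: below0_eq.
  - exact: (bI 0%N).
exists (i n), (a n + b n)%N, (M n); split; first by rewrite mxrank_ker.
have frI := homology_basis_free (sI n.+1) (sI n) (bI n).
have frA := homology_basis_free (sA n.+1) (sA n) (bA n).
have frB := homology_basis_free (sB n.+1) (sB n) (bB n).
apply: (@mv_basis _ _ _ _ _ (@dbelow_d n.+1) _ _ _ _ (sA _) (sB _) (sA _) (sB _)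
    (dA n.+1) (dB n.+1) _ _ _ _ _ (@zI n) _ (@zI n.+1) (@zA n.+1) (@zB n.+1)
    (MA n.+1) (MB n.+1)) => //=.
- move=> s t As Bt st; have [_ span] := bI n.
  have Ids : I n (d n s) by split; [exact: dA|rewrite st; apply: submoduleN => //; exact: dB].
  have [u [[y Iy uy] _]] := span _ Ids (dbelow_d s).
  by exists u; exists y.
- by move=> u y Ay By; apply: frI.
- move=> u; split.
    rewrite mul_mx_row mulmxN => /eqP; rewrite -row_mx0 => /eqP/eq_row_mx[uA /eqP].
    rewrite oppr_eq0 => /eqP uB.
    have [s As sE] := homology_transfer (sA n.+1) (MAP n) u.
    have [t Bt tE] := homology_transfer (sB n.+1) (MBP n) u.
    exists s, t; split=> //; first by rewrite -sE uA linear0 subr0.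
    by rewrite -tE uB linear0 subr0.
  move=> [s [t [As Bt sE tE]]].
  have [s' As' sE'] := homology_transfer (sA n.+1) (MAP n) u.
  have [t' Bt' tE'] := homology_transfer (sB n.+1) (MBP n) u.
  have uA : u *m MA n = 0.
    apply: (frA _ (s - s')); first exact: submoduleB.
    by rewrite linearB /= sE -sE' opprB addrC subrK.
  have uB : u *m MB n = 0.
    apply: (frB _ (t - t')); first exact: submoduleB.
    by rewrite linearB /= tE -tE' opprB addrC subrK.
  by rewrite mul_mx_row mulmxN uA uB oppr0 row_mx0.
Qed.

End MayerVietorisEuler.

(** Each rank [r n] occurs in two consecutive degrees, with opposite signs. *)
Lemma alternating_telescope (i r s t : nat -> nat) N :
  (forall n, r n <= i n)%N -> (forall n, r n <= t n)%N ->
  (forall n, s n = (t n - r n) + (if n is m.+1 then i m - r m else 0))%N ->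
  i N = 0%N ->
  \sum_(n < N.+1) (-1) ^+ n * (s n)%:Z =
  \sum_(n < N.+1) (-1) ^+ n * ((t n)%:Z - (i n)%:Z) :> int.
Proof.
move=> ri rt sE iN.
suff H m : \sum_(n < m.+1) (-1) ^+ n * (s n)%:Z =
    \sum_(n < m.+1) (-1) ^+ n * ((t n)%:Z - (i n)%:Z) + (-1) ^+ m * (i m - r m)%:Z :> int.
  by rewrite H iN sub0n mulr0 addr0.
elim: m => [|m IH].
  by rewrite !big_ord1 /= !expr0 !mul1r sE /= addn0 -!subzn //; ring.
rewrite big_ord_recr [in RHS]big_ord_recr /= IH sE exprS.
by rewrite PoszD -!subzn //; ring.
Qed.

Lemma has_euler_join A B x y z : subcomplex A -> subcomplex B ->
  has_euler (fun n => pred_meet (A n) (B n)) x -> has_euler A y -> has_euler B z ->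
  has_euler (fun n => pred_join (A n) (B n)) (y + z - x).
Proof.
move=> cA cB [N1 [i [hi i0 ->]]] [N2 [a [ha a0 ->]]] [N3 [b [hb b0 ->]]].
have bI n := svalP (cid (hi n)).
have bA n := svalP (cid (ha n)).
have bB n := svalP (cid (hb n)).
have [r [ri H]] := mayer_vietoris_betti cA cB bI bA bB.
pose N := (N1 + N2 + N3)%N.
pose s n := ((a n + b n - r n) + (if n is m.+1 then i m - r m else 0))%N.
exists N.+1, s; split=> [n|n Nn|]; first exact: (H n).2.
  case: n Nn => // n; rewrite /N /s => Nn.
  by rewrite a0 ?b0 ?i0; lia.
rewrite (@alternating_telescope i r s (fun n => a n + b n)%N) //; last 2 first.
- by move=> n; exact: (H n).1.
- by apply: i0; rewrite /N; lia.
have ext K K' (f : nat -> nat) : (forall n, (K <= n)%N -> f n = 0%N) -> (K <= K')%N ->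
    \sum_(n < K) (-1) ^+ n * (f n)%:Z = \sum_(n < K') (-1) ^+ n * (f n)%:Z :> int.
  move=> f0 /subnKC <-; rewrite big_split_ord /= [X in _ = _ + X]big1 ?addr0// => j _.
  by rewrite f0 ?mulr0// leq_addr.
rewrite (ext N1 N.+1 i) ?(ext N2 N.+1 a) ?(ext N3 N.+1 b) //; try by rewrite /N; lia.
rewrite -sumrN -!big_split /=; apply: eq_bigr => n _.
rewrite PoszD; ring.
Qed.

End Complexes.

(** * Standard simplices *)

Section StandardSimplex.
Variable R : realType.
Implicit Types n : nat.

Definition bary n (t : std_simplex R n) (i : 'I_n.+1) : R := (\val t) ord0 i.

Lemma bary_ge0 n (t : std_simplex R n) i : 0 <= bary t i.
Proof. by have [t0 _] := set_mem (svalP t); exact: t0. Qed.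

Lemma bary_sum n (t : std_simplex R n) : \sum_i bary t i = 1.
Proof. by have [] := set_mem (svalP t). Qed.

Lemma bary_le1 n (t : std_simplex R n) i : bary t i <= 1.
Proof.
rewrite -(bary_sum t) (bigD1 i) //= lerDl; apply: sumr_ge0 => j _; exact: bary_ge0.
Qed.

Lemma bary_inj n (t u : std_simplex R n) : bary t =1 bary u -> t = u.
Proof. by move=> tu; apply/val_inj/rowP => i; exact: tu. Qed.

Lemma row_simplex n (f : 'I_n.+1 -> R) : (forall i, 0 <= f i) -> \sum_i f i = 1 ->
  \row_i f i \in std_simplex R n.
Proof.
move=> f0 f1; apply/mem_set; split=> [i|]; first by rewrite mxE.
by rewrite -f1; apply: eq_bigr => i _; rewrite mxE.
Qed.

Definition mk_simplex n (f : 'I_n.+1 -> R) f0 f1 : std_simplex R n :=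
  exist (fun t => t \in std_simplex R n) _ (@row_simplex n f f0 f1).

Lemma bary_mk n f f0 f1 i : bary (@mk_simplex n f f0 f1) i = f i.
Proof. by rewrite /bary /= mxE. Qed.

Lemma vertex_ge0 n (k i : 'I_n.+1) : 0 <= (i == k)%:R :> R.
Proof. by []. Qed.

Lemma vertex_sum n (k : 'I_n.+1) : \sum_i (i == k)%:R = 1 :> R.
Proof. by rewrite (bigD1 k) //= eqxx big1 ?addr0 // => i /negPf ->. Qed.

Definition vertex n (k : 'I_n.+1) : std_simplex R n :=
  mk_simplex (vertex_ge0 k) (vertex_sum k).

(** A standard simplex has the topology induced from row vectors, so convergence may be
    tested on coordinates. *)
Lemma simplex_cvg (Z : Type) (F : set_system Z) {FF : Filter F} n
    (g : Z -> std_simplex R n) (t : std_simplex R n) :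
  (forall i, (fun z => bary (g z) i) @ F --> bary t i) -> g @ F --> t.
Proof.
move=> gt U [_ [[W oW <-]] /= Wt] /filterS; apply.
have [Q Qt sQW] : nbhs (\val t : 'rV[R]_n.+1) W by exact: open_nbhs_nbhs.
have : \forall z \near F, forall j, Q ord0 j (bary (g z) j).
  by apply: filter_forall => j; apply: gt; exact: Qt.
apply: filterS => z Qz; apply: sQW => i j /=.
by rewrite (ord1 i); exact: Qz.
Qed.

Lemma bary_continuous n (i : 'I_n.+1) : continuous (fun t : std_simplex R n => bary t i).
Proof.
move=> t; apply: (@continuous_comp _ _ _ set_val (fun M : 'rV[R]_n.+1 => M ord0 i)).
  exact: initial_continuous.
exact: coord_continuous.
Qed.

Lemma simplex_compact n : compact [set: std_simplex R n].
Proof.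
have cpt : compact (std_simplex R n).
  apply: bounded_closed_compact.
    exists 1; split=> // M M1 t [t0 t1]; rewrite /Num.norm /= mx_normrE.
    apply/bigmax_leP; split=> [|[i j] _ /=]; first exact: le_trans (ltW M1).
    rewrite (ord1 i) ger0_norm // (le_trans _ (ltW M1)) // -t1 (bigD1 j) //= lerDl.
    exact: sumr_ge0.
  have -> : std_simplex R n =
      (\bigcap_(i in [set: 'I_n.+1]) ((fun t : 'rV[R]_n.+1 => t ord0 i) @^-1` [set x | 0 <= x]))
      `&` ((fun t : 'rV[R]_n.+1 => \sum_i t ord0 i) @^-1` [set 1]).
    apply/seteqP; split=> t /= [t0 t1]; split=> //; first by move=> i _; exact: t0.
    by move=> i; exact: t0.
  apply: closedI.
    apply: closed_bigI => i _; apply: preimage_closed; last exact: closed_ge.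
    by move=> t _; exact: coord_continuous.
  apply: preimage_closed; last exact: closed_eq.
  by move=> t _; apply: continuous_big => [|i _]; [exact: add_continuous|exact: coord_continuous].
apply/compact_near_coveringP => I F P FF cov.
have /compact_near_coveringP/near_covering_withinP := cpt.
move=> /(_ I F (fun i t => forall h : t \in std_simplex R n, P i (exist _ t h)) FF) H.
suff : \near F, std_simplex R n `<=` fun t => forall h : t \in std_simplex R n, P F (exist _ t h).
  by apply: filterS => i iP [t h] _; exact: (iP t (set_mem h)).
apply: H => t st; have /= := cov (exist _ t (mem_set st)) Logic.I.
move=> [[A B] /= [[_ [[W oW <-] /= Wt] WA] FB] AB].
exists (W, B); first by split => //; exact: open_nbhs_nbhs.
move=> [u i] /= [Wu Bi] su h; apply: (AB (exist _ u h, i)); split => //.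
exact: WA.
Qed.

Lemma simplex_map_comp m n k (f : 'I_n.+1 -> 'I_k.+1) (g : 'I_m.+1 -> 'I_n.+1) t :
  simplex_map f (simplex_map g t) = simplex_map (f \o g) t :> std_simplex R k.
Proof.
apply: bary_inj => j; rewrite /bary /= /push_coord !mxE.
under eq_bigr do rewrite mxE.
rewrite (exchange_big_dep (fun i => f (g i) == j)) /=; last by move=> i l /eqP fi /eqP gl; rewrite gl fi.
apply: eq_bigr => i ij.
rewrite (eq_bigl (pred1 (g i))) ?big_pred1_eq // => l /=.
by rewrite [RHS]eq_sym andbC; case: eqVneq => //= <-.
Qed.

End StandardSimplex.

(** * Singular chains with small supports *)

Section SingularFaces.
Variables (R : realType) (T : topologicalType).
Local Notation chain := (singular_chain R T).
Local Notation simplices := (singular_simplex R T).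

Lemma boundaryU n (s : simplices n.+1) :
  boundary (<< s >> : chain n.+1) =
  \sum_(i < n.+2) (-1) ^+ i *: (<< singular_face i s >> : chain n).
Proof. by rewrite /boundary liftU scale1r. Qed.

Lemma singular_face_face n (i j : nat) (s : simplices n.+2) : (i < j)%N -> (j < n.+3)%N ->
  singular_face (inord i) (singular_face (inord j) s) =
  singular_face (inord j.-1) (singular_face (inord i) s).
Proof.
move=> ij jn; apply/continuousEP => t /=; congr (s _).
rewrite !simplex_map_comp; congr (simplex_map _ t : std_simplex R n.+2).
apply/funext => k; apply/val_inj; rewrite /= !inordK; [|lia..].
rewrite /bump; lia.
Qed.

Lemma boundary_boundary n (c : chain n.+2) : boundary (boundary c) = 0.
Proof.
apply: (@linear_chain_eq _ _ (@boundary R T n \o @boundary R T n.+1) \0) => s /=.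
rewrite boundaryU linear_sum /=; under eq_bigr do rewrite linearZ /= boundaryU scaler_sumr.
pose F (j i : nat) : chain n := << singular_face (inord i) (singular_face (inord j) s) >>.
pose G (j i : nat) := (-1) ^+ (j + i) *: F j i.
transitivity (\sum_(0 <= j < n.+3) \sum_(0 <= i < n.+2) G j i).
  rewrite big_mkord; apply: eq_bigr => j _; rewrite big_mkord; apply: eq_bigr => i _.
  by rewrite scalerA -exprD /G /F !inord_val.
(* The terms with [i < j] cancel the others, through the pairing of (j, i) with
   (i, j - 1). *)
have GE j i : (i < j)%N -> (j < n.+3)%N -> G j i = - G i j.-1.
  move=> ij jn; rewrite /G /F singular_face_face // -scaleNr; congr (_ *: _).
  by rewrite addnC; case: j ij jn => // j _ _; rewrite addnS exprS mulN1r.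
transitivity (\sum_(0 <= j < n.+3) \sum_(0 <= i < n.+2 | (j <= i)%N) G j i +
    \sum_(0 <= j < n.+3) \sum_(0 <= i < n.+2 | (i < j)%N) G j i).
  rewrite -big_split; apply: eq_bigr => j _; rewrite (bigID (fun i => (j <= i)%N)) /=.
  by congr (_ + _); apply: eq_bigl => i; rewrite ltnNge.

rewrite (exchange_big_dep_nat predT) //= [X in _ + X]big_nat_recl //=.
rewrite [X in _ + (X + _)]big_pred0 ?add0r // -big_split /=.
rewrite big_nat big1 // => a /andP[_ an].
rewrite big_mkcond big_nat_recr //= ltnNge -ltnS an /= addr0 -big_mkcond /=.
rewrite -big_split big_nat_cond big1 // => b /andP[_ ba].
by rewrite /= (GE a.+1 b) // subrr.
Qed.

Lemma singular_face_range n i (s : simplices n.+1) : range (singular_face i s) `<=` range s.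
Proof. by move=> _ [t _ <-]; exists (coface R i t). Qed.

Definition augmentation : {linear chain 0 -> rat^o} := extend (fun=> 1 : rat^o).

(** The boundary with its linearity bundled, as the results on complexes expect. *)
Definition bd n : {linear chain n.+1 -> chain n} := @boundary R T n.

Lemma bd_bd n c : bd n (bd n.+1 c) = 0. Proof. exact: boundary_boundary. Qed.

Lemma augmentation_bd (b : chain 1) : augmentation (bd 0 b) = 0.
Proof.
apply: (@linear_chain_eq _ _ (augmentation \o bd 0) \0) => s /=.
rewrite /bd /= boundaryU linear_sum /= !big_ord_recl big_ord0 /=.
rewrite !linearZ /= /augmentation /= !extendU.
by rewrite expr0 expr1 scaleN1r scale1r addr0 addrN.
Qed.

(** The predicate bears on images only, so that for a downward closed [P] these chains
    form a subcomplex stable under every operation that replaces a simplex by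
    reparametrizations of parts of it. *)
Definition small (P : set T -> Prop) : graded_pred chain :=
  fun n => supp (fun s : simplices n => P (range s)).
Arguments small : clear implicits.

Definition downward (P : set T -> Prop) := forall A B, A `<=` B -> P B -> P A.

Lemma supp_submodule (K : choiceType) (P : K -> Prop) : submodule (supp P).
Proof.
by split=> [|a u v Pu Pv]; [exact: supp0 | exact: suppD (suppZ Pu) Pv].
Qed.

Lemma boundary_extend n (c : chain n.+1) : bd n c = extend (fun s =>
  \sum_(i < n.+2) (-1) ^+ i *: (<< singular_face i s >> : chain n)) c.
Proof. by []. Qed.

Lemma small_subcomplex P : downward P -> subcomplex bd (small P).
Proof.
move=> downP; split=> [n|n c]; first exact: supp_submodule.
rewrite boundary_extend; apply: supp_extend => s Ps.
apply: supp_sum => i _; apply: (@suppZ _ _ _ _ (suppU _)).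
exact: downP (@singular_face_range n i s) Ps.
Qed.

Lemma small_meet P Q n :
  small (fun A => P A /\ Q A) n =1 pred_meet (small P n) (small Q n).
Proof.
move=> c; apply/propext; split=> [H|[Hp Hq] s sc]; last by split; [exact: Hp|exact: Hq].
by split=> s /H[].
Qed.

Lemma small_join P Q n :
  small (fun A => P A \/ Q A) n =1 pred_join (small P n) (small Q n).
Proof.
move=> c; apply/propext; split=> [/supp_or[a [b [? ? ->]]]|[a [b [Pa Qb ->]]]].
  by exists a, b.
by apply: suppD; [apply: supp_mono Pa => s; left|apply: supp_mono Qb => s; right].
Qed.

(** Intersections and sums of subcomplexes spanned by simplices correspond to
    conjunctions and disjunctions of the defining predicates. *)
Lemma has_euler_smallU P Q x y z : downward P -> downward Q ->
  has_euler bd (small (fun A => P A /\ Q A)) x ->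
  has_euler bd (small P) y -> has_euler bd (small Q) z ->
  has_euler bd (small (fun A => P A \/ Q A)) (y + z - x).
Proof.
move=> downP dQ.
have -> : small (fun A => P A /\ Q A) = fun n => pred_meet (small P n) (small Q n).
  by apply/functional_extensionality_dep => n; apply/funext; exact: small_meet.
have -> : small (fun A => P A \/ Q A) = fun n => pred_join (small P n) (small Q n).
  by apply/functional_extensionality_dep => n; apply/funext; exact: small_join.
by apply: has_euler_join; [exact: bd_bd| |]; exact: small_subcomplex.
Qed.

Lemma has_euler_small_empty P : (forall A, A !=set0 -> ~ P A) ->
  has_euler bd (small P) 0.
Proof.
move=> P0; exists 0%N, (fun=> 0%N); split=> // [n|]; last by rewrite big_ord0.
exists (fun=> 0); split=> [[]//|c Pc _].
have -> : c = 0.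
  apply/eqP; rewrite -dom_eq0; case E : (dom c) => [//|s r].
  have /Pc : s \in dom c by rewrite E mem_head.
  by move/P0; case; exists (s (vertex R ord0)), (vertex R ord0).
exists 0; split; last by move=> u _; rewrite [RHS]thinmx0.
exists 0; first exact: supp0.
by rewrite /lincomb big_ord0 subr0 linear0.
Qed.

End SingularFaces.
Arguments small {R T} P n c.
Arguments augmentation {R T}.
Arguments bd {R T} n.

(** * Contractible sets *)

Section Cone.
Variables (R : realType) (T : topologicalType).
Local Notation chain := (singular_chain R T).
Local Notation simplices := (singular_simplex R T).
Local Notation bd := (@bd R T).
Variables (U : set T) (h : T * R -> T) (c : T).

(** Continuity is asked for at points of [U] only, which accommodates homotopies that are
    natural on an open subset of a quotient space and extended arbitrarily. *)
Definition contracts_to :=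
  [/\ forall x l, U x -> 0 <= l <= 1 -> {for (x, l), continuous h},
      forall x, U x -> h (x, 0) = x,
      forall x, U x -> h (x, 1) = c &
      forall x l, U x -> 0 <= l <= 1 -> U (h (x, l))].

Hypothesis ctr : contracts_to.

Lemma tail_ge0 n (t : std_simplex R n.+1) : bary t ord0 < 1 ->
  forall i, 0 <= bary t (fintype.lift ord0 i) / (1 - bary t ord0).
Proof. by move=> t1 i; rewrite divr_ge0 ?bary_ge0 // subr_ge0 ltW. Qed.

Lemma tail_sum n (t : std_simplex R n.+1) : bary t ord0 < 1 ->
  \sum_i bary t (fintype.lift ord0 i) / (1 - bary t ord0) = 1.
Proof.
move=> t1; rewrite -mulr_suml; have := bary_sum t; rewrite big_ord_recl => tE.
rewrite -[X in _ / (X - _)]tE addrAC subrr add0r divff //.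
by move: t1; rewrite -tE; apply: contraTneq => ->; rewrite addr0 ltxx.
Qed.

(** Projection from the first vertex to the opposite face.  At that vertex, where the
    projection is undefined, any value will do: the contraction has become constant. *)
Definition tail n (t : std_simplex R n.+1) : std_simplex R n :=
  match pselect (bary t ord0 < 1) with
  | left t1 => mk_simplex (tail_ge0 t1) (tail_sum t1)
  | right _ => vertex R ord0
  end.

Lemma bary_tail n (t : std_simplex R n.+1) i : bary t ord0 < 1 ->
  bary (tail t) i = bary t (fintype.lift ord0 i) / (1 - bary t ord0).
Proof. by move=> t1; rewrite /tail; case: pselect => // t1'; rewrite bary_mk. Qed.

Lemma tail_continuous n (t : std_simplex R n.+1) : bary t ord0 < 1 ->
  {for t, continuous (@tail n)}.
Proof.
move=> t1.
have near1 : \forall u \near t, bary u ord0 < 1.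
  exact: (@cvgr_lt _ _ _ _ (fun u => bary u ord0) _ (@bary_continuous _ _ ord0 t)).
apply: (@simplex_cvg _ _ (nbhs t) _) => i; rewrite bary_tail //.
have : (fun u : std_simplex R n.+1 => bary u (fintype.lift ord0 i) / (1 - bary u ord0)) @ t -->
    bary t (fintype.lift ord0 i) / (1 - bary t ord0).
  apply: (@cvgM _ _ _ (nbhs_filter t)); first exact: bary_continuous.
  apply: (@cvgV _ _ _ (nbhs_filter t)); first by rewrite subr_eq0 gt_eqF.
  by apply: (@cvgB _ _ _ _ (nbhs_filter t)); [exact: cvg_cst|exact: bary_continuous].
apply: cvg_trans; apply: near_eq_cvg; apply: filterS near1 => u u1.
by rewrite bary_tail.
Qed.

(** The first barycentric coordinate serves as the time of the contraction. *)
Definition cone_fun n (s : simplices n) (t : std_simplex R n.+1) : T :=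
  h (s (tail t), bary t ord0).

(** Away from the cone point this is a composition.  At the cone point [tail] has no
    limit, but by compactness of the base [h] is uniformly close to [c] on the whole
    image of [s] when the time is close to 1. *)
Lemma cone_fun_continuous n (s : simplices n) : range s `<=` U -> continuous (cone_fun s).
Proof.
move=> sU t; have [hc h0 h1 hU] := ctr.
have I0 (u : std_simplex R n.+1) : 0 <= bary u ord0 <= 1 by rewrite bary_ge0 bary_le1.
have sUt u : U (s u) by apply: sU; exists u.
have [t1|t1] := ltP (bary t ord0) 1.
  apply: (@continuous_comp _ _ _ (fun t => (s (tail t), bary t ord0)) h); last exact: hc.
  apply: (@cvg_pair _ _ _ (nbhs t) (nbhs (s (tail t))) (nbhs (bary t ord0)) _ _ _
    (s \o @tail n) (fun u => bary u ord0)); last exact: bary_continuous.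
  apply: (@continuous_comp _ _ _ (@tail n) s); first exact: tail_continuous.
  exact: cts_fun.
have {}t1 : bary t ord0 = 1 by apply/eqP; rewrite eq_le bary_le1.
rewrite /continuous_at /cone_fun t1 h1 // => O Oc.
have /compact_near_coveringP cpt := @simplex_compact R n.
have near1 : \forall l \near (1 : R), forall u, O (h (s u, l)).
  have : \forall l \near (1 : R), [set: std_simplex R n] `<=` fun u => O (h (s u, l)).
    have H := cpt R (nbhs (1 : R)) (fun l u => O (h (s u, l))) _.
    apply: H => u _; have := hc (s u) 1 (sUt u).
    rewrite ler01 lexx => /(_ isT) /=; rewrite /prop_for /continuous_at h1 // => /(_ _ Oc).
    move=> [[A B] /= [As B1] AB].
    exists (s @^-1` A, B); first by split => //; exact: (@cts_fun _ _ s).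
    by move=> [u' l] /= [As' Bl]; exact: (AB (s u', l)).
  by apply: filterS => l Hl u; exact: (Hl u Logic.I).
have := @bary_continuous _ _ ord0 t; rewrite /continuous_at t1 => /(_ _ near1) near2.
by apply: (@filterS _ (nbhs t) _ _ _ _ near2) => u /=; apply.
Qed.

(** The value [cst c] is a placeholder for simplices outside [U]. *)
Definition cone n (s : simplices n) : simplices n.+1 :=
  match pselect (range s `<=` U) with
  | left sU => mkcts (cone_fun_continuous sU)
  | right _ => cst c
  end.

Lemma coneE n (s : simplices n) t : range s `<=` U -> cone s t = h (s (tail t), bary t ord0).
Proof. by rewrite /cone; case: pselect. Qed.

Lemma cone_range n (s : simplices n) : range s `<=` U -> range (cone s) `<=` U.
Proof.
move=> sU _ [t _ <-]; have [_ _ _ hU] := ctr; rewrite coneE //.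
by apply: hU; rewrite ?bary_ge0 ?bary_le1 //; apply: sU; eexists.
Qed.

Lemma bary_coface n (i : 'I_n.+2) (t : std_simplex R n) k :
  bary (coface R i t) (fintype.lift i k) = bary t k.
Proof.
rewrite /bary /coface /= /push_coord mxE (eq_bigl (pred1 k)) ?big_pred1_eq // => j /=.
exact: (inj_eq lift_inj).
Qed.

Lemma bary_coface0 n (i : 'I_n.+2) (t : std_simplex R n) : bary (coface R i t) i = 0.
Proof.
rewrite /bary /coface /= /push_coord mxE big_pred0 // => j.
by rewrite eq_sym (negPf (neq_lift _ _)).
Qed.

Lemma cone_face0 n (s : simplices n) : range s `<=` U -> singular_face ord0 (cone s) = s.
Proof.
move=> sU; apply/continuousEP => t; rewrite /singular_face /= coneE // bary_coface0.
have [_ h0 _ _] := ctr; rewrite h0; last by apply: sU; eexists.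
congr (s _); apply: bary_inj => i; rewrite bary_tail ?bary_coface0 ?ltr01 //.
by rewrite bary_coface subr0 divr1.
Qed.

Lemma bary_coface_lift0 n (i : 'I_n.+2) (t : std_simplex R n.+1) :
  bary (coface R (fintype.lift ord0 i) t) ord0 = bary t ord0.
Proof.
have <- : fintype.lift (fintype.lift ord0 i) ord0 = ord0 :> 'I_n.+3 by exact/val_inj.
exact: bary_coface.
Qed.

Lemma tail_coface n (i : 'I_n.+2) (t : std_simplex R n.+1) : bary t ord0 < 1 ->
  tail (coface R (fintype.lift ord0 i) t) = coface R i (tail t).
Proof.
move=> t1; apply: bary_inj => j; rewrite bary_tail ?bary_coface_lift0 //.
have [->|[k ->]] : j = i \/ exists k, j = fintype.lift i k.
  by case: (unliftP i j) => [k ->|->]; [right; exists k|left].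
  by rewrite !bary_coface0 mul0r.
rewrite bary_coface bary_tail //; congr (_ / _).
rewrite -(bary_coface (fintype.lift ord0 i)); congr (bary _ _).
by apply/val_inj; rewrite /= /bump; lia.
Qed.

Lemma cone_faceS n (i : 'I_n.+2) (s : simplices n.+1) : range s `<=` U ->
  singular_face (fintype.lift ord0 i) (cone s) = cone (singular_face i s).
Proof.
move=> sU; have [_ _ h1 _] := ctr.
have sU' : range (singular_face i s) `<=` U by apply: subset_trans sU; exact: singular_face_range.
apply/continuousEP => t; rewrite /singular_face /= coneE // coneE // bary_coface_lift0.
have [t1|t1] := ltP (bary t ord0) 1; first by rewrite tail_coface.
have -> : bary t ord0 = 1 by apply/eqP; rewrite eq_le bary_le1.
by rewrite !h1 //; [apply: sU'|apply: sU]; eexists.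
Qed.

Lemma cone_face1 (s : simplices 0) : range s `<=` U ->
  singular_face (fintype.lift ord0 ord0) (cone s) = cst c.
Proof.
move=> sU; have [_ _ h1 _] := ctr.
apply/continuousEP => t; rewrite /singular_face /= coneE //.
have -> : bary (coface R (fintype.lift ord0 ord0) t) ord0 = 1.
  have <- : fintype.lift (fintype.lift ord0 ord0) ord0 = ord0 :> 'I_2 by exact/val_inj.
  by rewrite bary_coface -(bary_sum t) big_ord1.
by rewrite h1 //; apply: sU; eexists.
Qed.

Definition cone_chain n : {linear chain n -> chain n.+1} :=
  extend (fun s => << cone s >>).

Lemma cone_chainU n (s : simplices n) : cone_chain n << s >> = << cone s >>.
Proof. exact: extendU. Qed.

(** The face opposite to the cone point is the simplex itself and the other faces are
    cones, so coning is a chain homotopy from the identity to zero in positive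
    degrees. *)
Lemma bd_cone n (b : chain n.+1) : small (fun A => A `<=` U) n.+1 b ->
  bd n.+1 (cone_chain n.+1 b) = b - cone_chain n (bd n b).
Proof.
pose f : {linear chain n.+1 -> chain n.+1} := bd n.+1 \o cone_chain n.+1.
pose g : {linear chain n.+1 -> chain n.+1} := idfun \- (cone_chain n \o bd n).
move=> bU; suff : f b = g b by [].
apply: supp_linear_eq bU _ => s sU; rewrite /f /g /=.
rewrite cone_chainU [LHS]boundaryU big_ord_recl expr0 scale1r cone_face0 //.
congr (_ + _); rewrite [X in cone_chain n X]boundaryU linear_sum -sumrN.
apply: eq_bigr => i _; rewrite cone_faceS // linearZ /= cone_chainU.
by rewrite /bump /= exprS mulN1r scaleNr.
Qed.

Lemma extend_cst (K : choiceType) (M : lmodType rat) (v : M) (b : {freeg K / rat}) :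
  extend (fun=> v) b = (extend (fun=> 1 : rat^o) b : rat) *: v.
Proof.
rewrite !extendE scaler_suml; apply: eq_bigr => x _.
by rewrite /GRing.scale /= mulr1.
Qed.

Definition base_point : chain 0 := << (cst c : simplices 0) >>.

(** In degree 0 the second face of a cone is the cone point. *)
Lemma bd_cone0 (b : chain 0) : small (fun A => A `<=` U) 0 b ->
  bd 0 (cone_chain 0 b) = b - augmentation b *: base_point.
Proof.
rewrite /augmentation -[X in _ - X]extend_cst.
pose f : {linear chain 0 -> chain 0} := bd 0 \o cone_chain 0.
pose g : {linear chain 0 -> chain 0} := idfun \- extend (fun=> base_point).
move=> bU; suff : f b = g b by [].
apply: supp_linear_eq bU _ => s sU; rewrite /f /g /=.
rewrite cone_chainU [LHS]boundaryU !big_ord_recl big_ord0 expr0 scale1r cone_face0 //.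
by rewrite addr0 expr1 scaleN1r cone_face1 // extendU.
Qed.

Lemma cone_small n b : small (fun A => A `<=` U) n b ->
  small (fun A => A `<=` U) n.+1 (cone_chain n b).
Proof. by apply: supp_extend => s sU; apply: suppU; exact: cone_range. Qed.

Lemma has_euler_contractible : U c -> has_euler bd (small (fun A => A `<=` U)) 1.
Proof.
move=> Uc; exists 1%N, (fun n => (n == 0)%N : nat).
split=> [n|[]//|]; last by rewrite big_ord1 expr0 mul1r.
have sub k : submodule (small (fun A => A `<=` U) k) by exact: supp_submodule.
case: n => [|n] /=.
  exists (fun=> base_point); apply: homology_basisI => //.
  - by move=> _; apply: suppU => _ [t _ <-].
  - move=> b bU _; exists (const_mx (augmentation b)), (cone_chain 0 b); first exact: cone_small.
    by rewrite bd_cone0 // /lincomb big_ord1 mxE.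
  - move=> u x xU ux; apply/rowP => i; rewrite (ord1 i) mxE.
    have := augmentation_bd x; rewrite -ux /lincomb big_ord1 linearZ /=.
    by rewrite /augmentation /base_point extendU /GRing.scale /= mulr1.
exists (fun=> 0); apply: homology_basisI => // [[]//|[]//|b bU /= b0|u x _ _]; last first.
  exact: thinmx0.
exists 0, (cone_chain n.+1 b); first exact: cone_small.
by rewrite bd_cone // (b0 : bd n b = 0) !linear0.
Qed.

End Cone.

(** * Barycentric subdivision *)

Section Pushforward.
Variable R : realType.
Local Notation chain := (singular_chain R).
Local Notation simplices := (singular_simplex R).

Definition push (T U : topologicalType) (f : continuousType T U) n :
  {linear chain T n -> chain U n} :=
  extend (fun s : simplices T n => (<< (f \o s : simplices U n) >> : chain U n)).

Lemma pushU (T U : topologicalType) (f : continuousType T U) n (s : simplices T n) :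
  push f n << s >> = << (f \o s : simplices U n) >>.
Proof. exact: extendU. Qed.

Lemma push_push (T U W : topologicalType) (f : continuousType T U)
    (g : continuousType U W) n (c : chain T n) :
  push g n (push f n c) = push (g \o f : continuousType T W) n c.
Proof.
apply: (@linear_chain_eq _ _ (push g n \o push f n) (push (g \o f) n)) => s /=.
by rewrite !pushU; congr << _ >>; exact/continuousEP.
Qed.

Lemma bd_push (T U : topologicalType) (f : continuousType T U) n (c : chain T n.+1) :
  bd n (push f n.+1 c) = push f n (bd n c).
Proof.
apply: (@linear_chain_eq _ _ (bd n \o push f n.+1) (push f n \o bd n)) => s /=.
rewrite pushU [LHS]boundaryU [X in push f n X]boundaryU linear_sum; apply: eq_bigr => i _.
by rewrite linearZ /= pushU; congr (_ *: << _ >>); exact/continuousEP.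
Qed.

Lemma supp_push (T U : topologicalType) (f : continuousType T U) n (P : simplices T n -> Prop)
    (Q : simplices U n -> Prop) c :
  (forall s, P s -> Q (f \o s)) -> supp P c -> supp Q (push f n c).
Proof. by move=> PQ; apply: supp_extend => s Ps; apply: suppU; exact: PQ. Qed.

End Pushforward.
Arguments push {R T U} f n.

Section StraightLine.
Variables (R : realType) (n : nat).
Local Notation D := (std_simplex R n).

(** Homotopies are parametrized by all of [R] with time truncated to the unit interval. *)
Definition clamp (l : R) : R := Num.min 1 (Num.max 0 l).

Lemma clamp_ge0 l : 0 <= clamp l.
Proof. by rewrite le_min ler01 le_max lexx. Qed.

Lemma clamp_le1 l : clamp l <= 1.
Proof. by rewrite ge_min lexx. Qed.

Lemma clamp0 : clamp 0 = 0.
Proof. by rewrite /clamp maxxx min_r // ler01. Qed.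

Lemma clamp1 : clamp 1 = 1.
Proof. by rewrite /clamp max_r ?ler01 // minxx. Qed.

Lemma clamp_continuous : continuous clamp.
Proof.
move=> l.
have cmax : {for l, continuous ((fun=> 0 : R^o) \max id)}.
  by apply: continuous_max => //; exact: cvg_cst.
by apply: (continuous_min _ cmax); exact: cvg_cst.
Qed.

Variable b : D.

Lemma line_ge0 (zl : D * R) i :
  0 <= (1 - clamp zl.2) * bary zl.1 i + clamp zl.2 * bary b i.
Proof.
by rewrite addr_ge0 // mulr_ge0 ?bary_ge0 ?clamp_ge0 // subr_ge0 clamp_le1.
Qed.

Lemma line_sum (zl : D * R) :
  \sum_i ((1 - clamp zl.2) * bary zl.1 i + clamp zl.2 * bary b i) = 1.
Proof. by rewrite big_split -!mulr_sumr !bary_sum /=; ring. Qed.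

Definition line (zl : D * R) : D := mk_simplex (line_ge0 zl) (line_sum zl).

Lemma bary_line z l i : 0 <= l <= 1 ->
  bary (line (z, l)) i = (1 - l) * bary z i + l * bary b i.
Proof.
by case/andP=> l0 l1; rewrite bary_mk /= /clamp max_r // min_r.
Qed.

Lemma line_continuous : continuous line.
Proof.
move=> zl; apply: (@simplex_cvg _ _ (nbhs zl) _) => i.
have -> : (fun z => bary (line z) i) =
    (fun zl => (1 - clamp zl.2) * bary zl.1 i + clamp zl.2 * bary b i).
  by apply/funext => z; rewrite bary_mk.
rewrite bary_mk.
have cl : (fun zl : D * R => clamp zl.2) @ nbhs zl --> clamp zl.2.
  apply: (@continuous_comp _ _ _ snd clamp); [exact: cvg_snd|exact: clamp_continuous].
have ba : (fun zl : D * R => bary zl.1 i) @ nbhs zl --> bary zl.1 i.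
  apply: (@continuous_comp _ _ _ fst (fun z => bary z i)); [exact: cvg_fst|exact: bary_continuous].
apply: (@cvgD _ _ _ _ (nbhs_filter zl)); apply: (@cvgM _ _ _ (nbhs_filter zl)) => //.
  by apply: (@cvgB _ _ _ _ (nbhs_filter zl)) => //; exact: cvg_cst.
exact: cvg_cst.
Qed.

(** A simplex is contractible to any of its points, hence chains in it can be coned off
    from that point. *)
Lemma line_contraction : contracts_to [set: D] line b.
Proof.
split=> //.
- by move=> x l _ _; exact: line_continuous.
- by move=> x _; apply: bary_inj => i; rewrite bary_line ?lexx ?ler01 //; ring.
- by move=> x _; apply: bary_inj => i; rewrite bary_line ?lexx ?ler01 //; ring.
Qed.

End StraightLine.

Section Subdivision.
Variable R : realType.
Local Notation chain := (singular_chain R).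
Local Notation simplices := (singular_simplex R).
Local Notation D := (std_simplex R).

Lemma barycenter_ge0 n (i : 'I_n.+1) : 0 <= (n.+1%:R)^-1 :> R.
Proof. by rewrite invr_ge0. Qed.

Lemma barycenter_sum n : \sum_(i < n.+1) (n.+1%:R)^-1 = 1 :> R.
Proof. by rewrite sumr_const card_ord -[RHS](@divff _ n.+1%:R) ?pnatr_eq0 // mulr_natl. Qed.

Definition barycenter n : D n := mk_simplex (@barycenter_ge0 n) (barycenter_sum n).

Definition bcone n k : {linear chain (D n) k -> chain (D n) k.+1} :=
  cone_chain (line_contraction (barycenter n)) k.

Lemma smallT n k (c : chain (D n) k) : small (fun A => A `<=` [set: D n]) k c.
Proof. by []. Qed.

Lemma bd_bcone n k (c : chain (D n) k.+1) :
  bd k.+1 (bcone n k.+1 c) = c - bcone n k (bd k c).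
Proof. exact/bd_cone/smallT. Qed.

Lemma bd_bcone0 n (c : chain (D n) 0) : augmentation c = 0 -> bd 0 (bcone n 0 c) = c.
Proof. by move=> c0; rewrite /bcone bd_cone0 // c0 scale0r subr0. Qed.

Definition id_simplex n : chain (D n) n := << (idfun : simplices (D n) n) >>.

(** A chain [u] of the standard simplex determines a natural operation on chains, which
    sends a singular simplex to the image of [u] under it.  Subdivision and its homotopy
    are defined in this way, so that they commute with [push] by construction. *)
Definition model_op (T : topologicalType) n k (u : chain (D n) k) : {linear chain T n -> chain T k} :=
  extend (fun s : simplices T n => push s k u).

Lemma model_opU (T : topologicalType) n k (u : chain (D n) k) (s : simplices T n) :
  model_op T u << s >> = push s k u.
Proof. exact: extendU. Qed.

Lemma model_op_push (T U : topologicalType) (f : continuousType T U) n k (u : chain (D n) k) c :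
  model_op U u (push f n c) = push f k (model_op T u c).
Proof.
apply: (@linear_chain_eq _ _ (model_op U u \o push f n) (push f k \o model_op T u)) => s /=.
by rewrite pushU !model_opU push_push.
Qed.

Lemma push_id_simplex (T : topologicalType) n (s : simplices T n) : push s n (id_simplex n) = << s >>.
Proof. by rewrite pushU; congr << _ >>; exact/continuousEP. Qed.

Lemma model_op_id (T : topologicalType) n (u : chain (D n) n) :
  u = id_simplex n -> forall c, model_op T u c = c.
Proof.
move=> -> c; apply: (@linear_chain_eq _ _ (model_op T (id_simplex n)) idfun) => s /=.
by rewrite model_opU push_id_simplex.
Qed.

(** The subdivided simplex is the cone, from its barycenter, over its subdivided
    boundary. *)
Fixpoint sd_model n : chain (D n) n :=
  if n is m.+1 then
    bcone m.+1 m (model_op (D m.+1) (sd_model m) (bd m (id_simplex m.+1)))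
  else id_simplex 0.

Definition sd (T : topologicalType) n : {linear chain T n -> chain T n} := model_op T (sd_model n).

Lemma sd_modelS n : sd_model n.+1 = bcone n.+1 n (sd (D n.+1) n (bd n (id_simplex n.+1))).
Proof. by []. Qed.

Lemma sd0 (T : topologicalType) (c : chain T 0) : sd T 0 c = c.
Proof. exact: model_op_id. Qed.

Lemma augmentation_bd_id_simplex : augmentation (sd (D 1) 0 (bd 0 (id_simplex 1))) = 0.
Proof. by rewrite sd0 augmentation_bd. Qed.

(** By naturality it suffices to treat the identity simplex, where the boundary of the
    cone is its base because the base, the subdivision of a boundary, is a cycle. *)
Lemma bd_sd (T : topologicalType) n (c : chain T n.+1) :
  bd n (sd T n.+1 c) = sd T n (bd n c).
Proof.
elim: n T c => [|n IH] T c;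
  apply: (@linear_chain_eq _ _ (bd _ \o sd T _) (sd T _ \o bd _)) => s /=;
  rewrite [sd T _.+1 _]model_opU bd_push sd_modelS.
  rewrite bd_bcone0 ?augmentation_bd_id_simplex // -model_op_push -bd_push.
  by rewrite push_id_simplex.
rewrite bd_bcone IH bd_bd linear0 linear0 subr0 -model_op_push -bd_push.
by rewrite push_id_simplex.
Qed.

(** The recursion is forced by the equation of [bd_sd_htpy]: the identity simplex, minus
    the homotopy on its boundary, has the same boundary as its subdivision up to a
    cone. *)
Fixpoint sd_htpy_model n : chain (D n) n.+1 :=
  if n is m.+1 then
    bcone m.+1 m.+1 (id_simplex m.+1 - model_op (D m.+1) (sd_htpy_model m) (bd m (id_simplex m.+1)))
  else 0.

Definition sd_htpy (T : topologicalType) n : {linear chain T n -> chain T n.+1} :=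
  model_op T (sd_htpy_model n).

(** The term [sd_htpy (bd c)] of the homotopy equation, absent in degree 0. *)
Definition sd_htpy_bd (T : topologicalType) n : chain T n -> chain T n :=
  match n with 0 => fun=> 0 | m.+1 => fun c => sd_htpy T m (bd m c) end.

Lemma sd_htpy0 (T : topologicalType) (c : chain T 0) : sd_htpy T 0 c = 0.
Proof.
apply: (@linear_chain_eq _ _ (sd_htpy T 0) \0) => s /=.
by rewrite [LHS]model_opU linear0.
Qed.

(** For the identity simplex the equation follows from [bd_bcone]: by induction the chain
    under the cone has the subdivided boundary as its boundary, whose cone is the
    subdivision. *)
Lemma bd_sd_htpy (T : topologicalType) n (c : chain T n) :
  bd n (sd_htpy T n c) = c - sd T n c - sd_htpy_bd c.
Proof.
elim: n T c => [|n IH] T c; first by rewrite sd0 subrr subr0 sd_htpy0 linear0.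
pose f : {linear chain T n.+1 -> chain T n.+1} := bd n.+1 \o sd_htpy T n.+1.
pose g : {linear chain T n.+1 -> chain T n.+1} :=
  (idfun \- sd T n.+1) \- (sd_htpy T n \o bd n).
suff : f c = g c by [].
apply: linear_chain_eq => s; rewrite {}/f {}/g /=.
have dtop0 : sd_htpy_bd (bd n (id_simplex n.+1)) = 0.
  by case: n {IH s c} => //= n; rewrite bd_bd linear0.
have htE : sd_htpy_model n.+1 =
    bcone n.+1 n.+1 (id_simplex n.+1 - sd_htpy (D n.+1) n (bd n (id_simplex n.+1))).
  by [].
have bd_htop : bd n.+1 (sd_htpy_model n.+1) =
    id_simplex n.+1 - sd_model n.+1 - sd_htpy (D n.+1) n (bd n (id_simplex n.+1)).
  rewrite htE bd_bcone (linearB (bd n)) IH dtop0 subr0 subKr.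
  by rewrite -sd_modelS addrAC.
rewrite [sd_htpy T _.+1 _]model_opU bd_push bd_htop !linearB /= push_id_simplex.
by rewrite -model_op_push -bd_push push_id_simplex [sd T n.+1 _]model_opU.
Qed.

Lemma model_op_small (T : topologicalType) (P : set T -> Prop) n k (u : chain (D n) k) c :
  downward P -> small P n c -> small P k (model_op T u c).
Proof.
move=> downP; apply: supp_extend => s Ps.
apply: (@supp_push _ _ _ _ _ (fun=> True)) => // s' _.
by apply: downP Ps => _ [t _ <-]; exists (s' t).
Qed.

Lemma sd_small (T : topologicalType) (P : set T -> Prop) n c :
  downward P -> small P n c -> small P n (sd T n c).
Proof. exact: model_op_small. Qed.

Lemma iter_sd_small (T : topologicalType) (P : set T -> Prop) n c m :
  downward P -> small P n c -> small P n (iter m (sd T n) c).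
Proof. by move=> downP Pc; elim: m => [//|m IH] /=; exact: sd_small. Qed.

Definition bd_small (T : topologicalType) (P : set T -> Prop) n : chain T n -> Prop :=
  match n with 0 => fun=> True | m.+1 => fun c => small P m (bd m c) end.

(** Subdividing a chain with small boundary changes it by a boundary and a small chain,
    the latter coming from the homotopy applied to the boundary. *)
Lemma iter_sd_homologous (T : topologicalType) (P : set T -> Prop) n (c : chain T n) m :
  downward P -> bd_small P c ->
  bd_small P (iter m (sd T n) c) /\
  exists x y, small P n y /\ c - iter m (sd T n) c = bd n x + y.
Proof.
move=> downP Pc; have sP k : submodule (small P k) by exact: supp_submodule.
elim: m => [|m [IH1 [x [y [Py xyE]]]]].
  split=> //; exists 0, 0; split; first exact: supp0.
  by rewrite subrr linear0 addr0.
set c' := iter m _ c in IH1 xyE *; split.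
  case: n c Pc @c' IH1 x y Py xyE => //= n c Pc c' IH1 x y Py xyE.
  by rewrite bd_sd; exact: sd_small.
have Ph : small P n (sd_htpy_bd c').
  case: n c Pc @c' IH1 x y Py xyE => [|n] c Pc c' IH1 x y Py xyE; first exact: supp0.
  exact: model_op_small.
exists (x + sd_htpy T n c'), (y + sd_htpy_bd c'); split; first exact: suppD Py Ph.
rewrite linearD addrACA -xyE /= bd_sd_htpy subrK.
by rewrite addrA subrK.
Qed.

End Subdivision.

(** * Small chains compute homology *)

Section Shrinking.
Variable R : realType.
Local Notation chain := (singular_chain R).
Local Notation simplices := (singular_simplex R).
Local Notation D := (std_simplex R).

Definition osc_le n (v : 'I_n.+1 -> R) (d : R) := forall i j, `|v i - v j| <= d.

(** [tau] is affine and every affine function oscillates on its image at most [r] times as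
    much as on the whole simplex.  Affine functions [v] and their restrictions [w] are
    given by values at vertices.  Bounding oscillations instead of distances makes the
    property multiplicative under composition. *)
Definition shrinks k n (r : R) (tau : simplices (D n) k) := forall v,
  exists2 w : 'I_k.+1 -> R,
    forall t, \sum_j bary (tau t) j * v j = \sum_i bary t i * w i &
    forall d, osc_le v d -> osc_le w (r * d).

Lemma osc_ge0 n (v : 'I_n.+1 -> R) d : osc_le v d -> 0 <= d.
Proof. by move=> /(_ ord0 ord0); exact: le_trans. Qed.

Lemma shrinks_id n : shrinks 1 (idfun : simplices (D n) n).
Proof. by move=> v; exists v => // d; rewrite mul1r. Qed.

Lemma shrinks_comp k l n r r' (tau : simplices (D n) k) (tau' : simplices (D k) l) :
  shrinks r tau -> shrinks r' tau' -> shrinks (r * r') (tau \o tau' : simplices (D n) l).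
Proof.
move=> st st' v; have [w tw ow] := st v; have [w' tw' ow'] := st' w.
exists w' => [t|d vd]; first by rewrite tw tw'.
by rewrite -mulrA mulrCA; apply: ow'; exact: ow.
Qed.

Lemma convex_dist n (t : D n) (v : 'I_n.+1 -> R) a e :
  (forall j, `|a - v j| <= e) -> `|a - \sum_j bary t j * v j| <= e.
Proof.
move=> ae; have -> : a - \sum_j bary t j * v j = \sum_j bary t j * (a - v j).
  by under [RHS]eq_bigr do rewrite mulrBr; rewrite sumrB -mulr_suml bary_sum mul1r.
rewrite (le_trans (ler_norm_sum _ _ _)) // -[e]mul1r -(bary_sum t) mulr_suml.
by apply: ler_sum => j _; rewrite normrM ger0_norm ?bary_ge0 // ler_wpM2l ?bary_ge0.
Qed.

Definition sd_ratio n : R := n%:R / n.+1%:R.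

Lemma sd_ratio_ge0 n : 0 <= sd_ratio n. Proof. by rewrite divr_ge0. Qed.

Lemma sd_ratio_lt1 n : sd_ratio n < 1.
Proof. by rewrite ltr_pdivrMr ?ltr0n // mul1r ltr_nat. Qed.

Lemma sd_ratio_le n : sd_ratio n <= sd_ratio n.+1.
Proof.
rewrite /sd_ratio ler_pdivrMr ?ltr0n // mulrAC ler_pdivlMr ?ltr0n //.
by rewrite -!natrM ler_nat; lia.
Qed.

(** The term of the average that compares a vertex with itself vanishes, which is what
    gains the factor n / (n + 1). *)
Lemma barycenter_dist n (v : 'I_n.+1 -> R) d j : osc_le v d ->
  `|\sum_i bary (barycenter R n) i * v i - v j| <= sd_ratio n * d.
Proof.
move=> vd; have -> : \sum_i bary (barycenter R n) i * v i - v j =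
    \sum_i bary (barycenter R n) i * (v i - v j).
  by under [RHS]eq_bigr do rewrite mulrBr; rewrite sumrB -mulr_suml bary_sum mul1r.
rewrite (bigD1 j) //= subrr mulr0 add0r (le_trans (ler_norm_sum _ _ _)) //.
apply: (@le_trans _ _ (\sum_(i < n.+1 | i != j) n.+1%:R^-1 * d)).
  apply: ler_sum => i _; rewrite normrM bary_mk ger0_norm ?invr_ge0 //.
  by rewrite ler_wpM2l ?invr_ge0.
rewrite sumr_const cardC1 card_ord -[leLHS]mulr_natl mulrA /=.
by [].
Qed.

Lemma tail_scale n (t : D n.+1) i :
  (1 - bary t ord0) * bary (tail t) i = bary t (fintype.lift ord0 i).
Proof.
have [t1|t1] := ltP (bary t ord0) 1.
  by rewrite bary_tail // mulrC divfK // subr_eq0 gt_eqF.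
have {}t1 : bary t ord0 = 1 by apply/eqP; rewrite eq_le bary_le1.
rewrite t1 subrr mul0r; apply/esym/eqP; rewrite eq_le bary_ge0 andbT.
have := bary_sum t; rewrite big_ord_recl t1 -[RHS]addr0 => /addrI s0.
by rewrite -[leRHS]s0 (bigD1 i) //= lerDl; apply: sumr_ge0 => j _; exact: bary_ge0.
Qed.

Lemma sum_vertex n (k : 'I_n.+1) (w : 'I_n.+1 -> R) :
  \sum_i bary (vertex R k) i * w i = w k.
Proof.
rewrite (bigD1 k) //= bary_mk eqxx mul1r big1 ?addr0 // => i ik.
by rewrite bary_mk (negPf ik) mul0r.
Qed.

Lemma sum_coface n (i : 'I_n.+2) (t : D n) (v : 'I_n.+2 -> R) :
  \sum_j bary (coface R i t) j * v j = \sum_k bary t k * v (fintype.lift i k).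
Proof.
rewrite (bigD1_ord i) //= bary_coface0 mul0r add0r.
by apply: eq_bigr => k _; rewrite bary_coface.
Qed.

(** The new vertex of the cone is the barycenter, the others lie on a face already
    treated, where the smaller ratio of the lower dimension is available. *)
Lemma cone_shrinks n i (tau : simplices (D n) n) : shrinks (sd_ratio n) tau ->
  shrinks (sd_ratio n.+1)
    (cone (line_contraction (barycenter R n.+1)) (coface R i \o tau : simplices (D n.+1) n)).
Proof.
move=> st v; have [w' tw' ow'] := st (fun k => v (fintype.lift i k)).
pose a := \sum_i bary (barycenter R n.+1) i * v i.
have tauE t : \sum_j bary (coface R i (tau t)) j * v j = \sum_k bary t k * w' k.
  by rewrite sum_coface.
exists (fun j => if unlift ord0 j is Some k then w' k else a).
  move=> t; rewrite [RHS]big_ord_recl unlift_none.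
  under [X in _ = _ + X]eq_bigr do rewrite liftK -tail_scale -mulrA.
  rewrite -mulr_sumr -tauE /a !mulr_sumr -big_split; apply: eq_bigr => j _ /=.
  rewrite coneE // bary_line ?bary_ge0 ?bary_le1 //=; ring.
move=> d vd; have d0 := osc_ge0 vd.
have aw k : `|a - w' k| <= sd_ratio n.+1 * d.
  rewrite -(sum_vertex k w') -tauE; apply: convex_dist => j; exact: barycenter_dist.
move=> j k; case: unliftP => [j' _|_]; case: unliftP => [k' _|_].
- apply: (@le_trans _ _ (sd_ratio n * d)); last by rewrite ler_wpM2r // sd_ratio_le.
  by apply: ow' => ? ?; exact: vd.
- by rewrite distrC.
- by [].
- by rewrite subrr normr0 mulr_ge0 ?sd_ratio_ge0.
Qed.

Lemma sd_model_shrinks n : supp (shrinks (sd_ratio n)) (sd_model R n).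
Proof.
elim: n => [|n IH].
  apply: suppU => v; exists v => // d _ i j.
  by rewrite (ord1 i) (ord1 j) subrr normr0 /sd_ratio !mul0r.
rewrite sd_modelS.
apply: (@supp_extend _ _ (fun rho => exists i (tau : simplices (D n) n),
    shrinks (sd_ratio n) tau /\ rho = (coface R i \o tau : simplices _ _))).
  by move=> _ [i [tau [st ->]]]; apply: suppU; exact: cone_shrinks.
rewrite /sd [bd n _]boundaryU; apply: (@supp_extend _ _ (fun rho => exists i, rho = coface R i)).
  move=> _ [i ->]; apply: supp_push IH => tau st; exists i, tau; split=> //.
apply: supp_sum => i _; apply: suppZ; apply: suppU; exists i; exact/continuousEP.
Qed.

Definition shrunk (T : topologicalType) n r (s s' : simplices T n) :=
  exists2 tau : simplices (D n) n, shrinks r tau & s' = (s \o tau : simplices T n).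

Lemma iter_sd_shrunk (T : topologicalType) n (s : simplices T n) m :
  supp (shrunk (sd_ratio n ^+ m) s) (iter m (sd R T n) << s >>).
Proof.
elim: m => [|m IH].
  by apply: suppU; exists (idfun : simplices (D n) n); [exact: shrinks_id|exact/continuousEP].
rewrite iterS; apply: supp_extend IH => _ [tau st ->].
apply: supp_push (@sd_model_shrinks n) => tau' st'.
exists (tau \o tau' : simplices (D n) n); first by rewrite exprSr; exact: shrinks_comp.
exact/continuousEP.
Qed.

Lemma shrinks_bary n k r (tau : simplices (D n) k) t t' j : shrinks r tau ->
  `|bary (tau t) j - bary (tau t') j| <= r.
Proof.
move=> /(_ (fun l => (l == j)%:R)) [w tw ow].
have E u : bary (tau u) j = \sum_i bary u i * w i.
  rewrite -tw (bigD1 j) //= eqxx mulr1 big1 ?addr0 // => l /negPf ->.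
  by rewrite mulr0.
have {}ow : osc_le w r.
  rewrite -[r]mulr1; apply: ow => i i'.
  by case: (i == j); case: (i' == j); rewrite ?subrr ?subr0 ?sub0r ?normrN ?normr0 ?normr1.
rewrite !E; apply: convex_dist => i; rewrite distrC; apply: convex_dist => i'.
exact: ow.
Qed.

Section SmallChains.
Variables (T : topologicalType) (P : set T -> Prop).
Hypothesis downP : downward P.
Hypothesis locallyP : forall x, exists U, [/\ open U, U x & P U].

(** The Lebesgue number lemma for the preimages under [s] of the sets satisfying [P]. *)
Lemma lebesgue_number n (s : simplices T n) : exists2 e : R, 0 < e &
  forall t, P (s @` [set u | forall j, `|bary u j - bary t j| < e]).
Proof.
have /compact_near_coveringP cpt := @simplex_compact R n.
pose Q (e : R) (t : D n) := P (s @` [set u | forall j, `|bary u j - bary t j| < e]).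
have : \forall e \near 0^'+, [set: D n] `<=` Q e.
  apply: cpt => t _; have [U [oU Ut PU]] := locallyP (s t).
  have : nbhs t (s @^-1` U) by apply: (@cts_fun _ _ s); exact: open_nbhs_nbhs.
  move=> [_ [[W oW <-] /= Wt] WU].
  have /nbhs_ballP [d /= d0 dW] : nbhs (\val t : 'rV[R]_n.+1) W by exact: open_nbhs_nbhs.
  have d20 : 0 < d / 2 by rewrite divr_gt0.
  exists ([set u | forall j, `|bary t j - bary u j| < d / 2], [set e : R | e < d / 2]).
    split; last exact: nbhs_right_lt.
    apply: (@filter_forall _ _ _ (nbhs t) (nbhs_filter t)) => j.
    have := @bary_continuous R n j t => /(_ [set y | `|bary t j - y| < d / 2]); apply.
    by apply/nbhs_ballP; exists (d / 2).
  move=> [u e] /= [ut ed]; apply: downP PU => _ [u' u'u <-]; apply: WU => /=.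
  apply: dW; split=> // i j; rewrite (ord1 i).
  change (`|bary t j - bary u' j| < d).
  rewrite -(subrKA (bary u j)) (le_lt_trans (ler_normD _ _)) // (splitr d).
  have := lt_trans (u'u j) ed; rewrite distrC => u'd; exact: ltrD (ut j) u'd.
move=> /(filterI (nbhs_right_gt 0)) /filter_ex [e [/= e0 He]].
by exists e => // t; exact: He.
Qed.

Lemma eventually_small1 n (s : simplices T n) :
  exists m, small P n (iter m (sd R T n) << s >>).
Proof.
have [e e0 He] := lebesgue_number s.
have [m me] : exists m, sd_ratio n ^+ m < e.
  have : (fun m => sd_ratio n ^+ m) @ \oo --> (0 : R).
    by apply: cvg_expr; rewrite ger0_norm ?sd_ratio_ge0 ?sd_ratio_lt1.
  move=> /cvgr_lt /(_ _ e0) [m _ /(_ m)]; rewrite /= leqnn => /(_ isT) ?.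
  by exists m.
exists m; apply: (supp_mono (P := shrunk (sd_ratio n ^+ m) s)); last exact: iter_sd_shrunk.
move=> _ [tau st ->].
apply: downP (He (tau (vertex R ord0))) => _ [t _ <-] /=.
exists (tau t) => // j; exact: le_lt_trans (shrinks_bary _ _ _ st) me.
Qed.

Lemma eventually_small n (c : chain T n) : exists m, small P n (iter m (sd R T n) c).
Proof.
have [m Hm] : exists m, forall s, s \in dom c -> small P n (iter m (sd R T n) << s >>).
  elim: (dom c) => [|s r [m IH]]; first by exists 0%N.
  have [m' Hm'] := eventually_small1 s; exists (m + m')%N => s'.
  rewrite inE => /orP[/eqP ->|s'r]; first by rewrite iterD; exact: iter_sd_small.
  by rewrite addnC iterD; apply: iter_sd_small => //; exact: IH.
exists m; have itlin : forall c', iter m (sd R T n) (\sum_(s <- dom c) coeff s c *: c' s) =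
    \sum_(s <- dom c) coeff s c *: iter m (sd R T n) (c' s).
  move=> c'; elim: m {Hm} => [//|m IH] /=; rewrite IH linear_sum; apply: eq_bigr => s _.
  by rewrite linearZ.
rewrite (chain_sum c) itlin big_seq; apply: supp_sum => s sc.
exact: suppZ (Hm s sc).
Qed.

(** A chain is homologous to a small one as soon as its boundary is small.  With the
    boundary zero this gives surjectivity in homology, and applied to a chain bounded
    by a small cycle it gives injectivity. *)
Lemma homologous_small n (c : chain T n) : bd_small P c ->
  exists c' x, small P n c' /\ c = c' + bd n x.
Proof.
move=> Pc; have [m Hm] := eventually_small c.
have [_ [x [y [Py E]]]] := iter_sd_homologous m downP Pc.
exists (iter m (sd R T n) c + y), x; split; first exact: suppD.
by rewrite -addrA [y + _]addrC -E addrC subrK.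
Qed.

Lemma has_betti_is_betti n k : has_betti (@bd R T) (small P) n k -> @is_betti R T n k.
Proof.
move=> [z [zc span]]; exists z; split=> [i|c cc].
  by have [_] := zc i; case: n z zc span.
have c0 : dbelow (@bd R T) n c = 0.
  by case: n c cc z zc span => [|n] c cc z zc span //; exact: below0_eq.
have Pc : bd_small P c.
  case: n c cc c0 z zc span => [|n] c cc c0 z zc span //=.
  rewrite (_ : bd n c = 0) //; exact: supp0.
have [c' [x [Pc' cE]]] := homologous_small Pc.
have c'0 : dbelow (@bd R T) n c' = 0.
  by have := c0; rewrite cE linearD /= dbelow_d ?addr0 //; exact: bd_bd.
have [a [[b Pb ab] ua]] := span _ Pc' c'0.
exists a; split=> [|a' [b' ab']].
  exists (b + x); rewrite [RHS](linearD (bd n)) -ab cE addrAC //.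
apply: ua.
have : bd_small P (b' - x).
  rewrite /= linearB /= [X in X - _](_ : _ = c - lincomb z a') //.
  rewrite cE addrAC addrK.
  apply: suppB => //; apply: submodule_lincomb; first exact: supp_submodule.
  by move=> i; case: (zc i).
move=> /homologous_small[b'' [y [Pb'' bE]]]; exists b'' => //.
have : bd n (b' - x) = bd n b'' by rewrite bE linearD /= bd_bd addr0.
by move=> <-; rewrite linearB /= [bd n b'](_ : _ = c - lincomb z a') // cE addrAC addrK.
Qed.

Lemma has_euler_is_euler chi :
  has_euler (@bd R T) (small P) chi -> @is_euler_characteristic R T chi.
Proof.
move=> [N [b [hb b0 ->]]]; exists N, b; split=> // n; exact: has_betti_is_betti.
Qed.

End SmallChains.
End Shrinking.

(** * Euler characteristic of a good cover *)

Section Nerve.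
Variables (R : realType) (T : topologicalType) (I : finType).
Variables (U : I -> set T) (K : pred {set I}).

Definition common (S : {set I}) : set T := [set x | forall i, i \in S -> U i x].

Hypothesis U_open : forall i, open (U i).
Hypothesis U_cover : forall x, exists i, U i x.
Hypothesis K_contr : forall S : {set I}, S != finset.set0 -> K S ->
  exists (h : T * R -> T) c, contracts_to (common S) h c /\ common S c.
Hypothesis K_empty : forall S : {set I}, S != finset.set0 -> ~~ K S -> forall x, ~ common S x.

(** The family to which induction on [s] applies: splitting off an index [i] separates the
    subsets of [common (i |: S)], and intersecting with these adds [i] to [S]. *)
Definition covered (S : {set I}) (s : seq I) (A : set T) :=
  A `<=` common S /\ exists2 i, i \in s & A `<=` U i.

Lemma covered_downward S s : downward (covered S s).
Proof.
move=> A B AB [BS [i si Bi]]; split; first exact: subset_trans BS.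
by exists i => //; exact: subset_trans Bi.
Qed.

Lemma common_setU1 i (S : {set I}) A :
  A `<=` common (i |: S) <-> A `<=` common S /\ A `<=` U i.
Proof.
split=> [H|[HS Hi] x Ax j].
  split=> x /H Hx; last by apply: Hx; rewrite setU11.
  by move=> j Sj; apply: Hx; rewrite setU1r.
by rewrite !inE => /orP[/eqP ->|Sj]; [exact: Hi|exact: HS].
Qed.

Fixpoint incl_excl (S : {set I}) (s : seq I) : int :=
  if s is i :: s' then (K (i |: S))%:Z + incl_excl S s' - incl_excl (i |: S) s' else 0.

Lemma has_euler_covered S s : has_euler (@bd R T) (small (covered S s)) (incl_excl S s).
Proof.
elim: s S => [|i s IH] S /=.
  by apply: has_euler_small_empty => A _ [_ []].
pose P1 A := A `<=` common (i |: S).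
have -> : covered S (i :: s) = fun A => P1 A \/ covered S s A.
  apply/funext => A; apply/propext; split.
    move=> [AS [j]]; rewrite inE => /orP[/eqP -> Ai|sj Aj]; last by right; split=> //; exists j.
    by left; apply/common_setU1.
  move=> [/common_setU1[AS Ai]|[AS [j sj Aj]]]; split=> //.
    by exists i => //; rewrite mem_head.
  by exists j => //; rewrite inE sj orbT.
apply: has_euler_smallU => //.
- by move=> A B AB; exact: subset_trans.
- exact: covered_downward.
- have -> : (fun A => P1 A /\ covered S s A) = covered (i |: S) s.
    apply/funext => A; apply/propext; split; first by move=> [? [_ ?]].
    by move=> [HA ?]; split=> //; split=> //; have [] := (common_setU1 i S A).1 HA.
  exact: IH.
have S0 : i |: S != finset.set0 by apply/set0Pn; exists i; rewrite setU11.
case: (boolP (K (i |: S))) => KS; last first.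
  by apply: has_euler_small_empty => A [x Ax] HA; exact: K_empty S0 KS x (HA _ Ax).
have [h [c [ctr Uc]]] := K_contr S0 KS.
exact: has_euler_contractible ctr Uc.
Qed.

(** Sorting the subsets by whether they contain the head of the list reproduces the
    recursion, up to the term of the empty set. *)
Lemma incl_exclE (S : {set I}) s : uniq s ->
  incl_excl S s = (K S)%:Z -
    \sum_(A : {set I} | A \subset [set:: s]) (-1) ^+ #|A| * (K (S :|: A))%:Z.
Proof.
elim: s S => [|i s IH] S /=.
  move=> _; rewrite (eq_bigl (pred1 finset.set0)) ?big_pred1_eq; last first.
    by move=> A; rewrite /= -finset.subset0; congr (_ \subset _); apply/setP => x; rewrite !inE.
  by rewrite cards0 expr0 mul1r finset.setU0 subrr.
move=> /andP[si us]; rewrite !IH //.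
rewrite [in RHS](bigID (fun A : {set I} => i \in A)) /=.
set a := \sum_(A | _) _; set b := \sum_(A | _) _.
set a' := \sum_(A | _) _; set b' := \sum_(A | _) _.
have -> : b' = a.
  apply: eq_bigl => A; apply/andP/idP=> [[/fintype.subsetP As iA]|/fintype.subsetP As].
    apply/fintype.subsetP => x xA; have := As x xA; rewrite !inE => /orP[/eqP xi|//].
    by rewrite -xi xA in iA.
  split; first by apply/fintype.subsetP => x /As; rewrite !inE => ->; rewrite orbT.
  by apply: contra si => /As; rewrite inE.
suff -> : a' = - b by ring.
rewrite /a' (reindex_onto (fun A => i |: A) (fun A => A :\ i)) /=; last first.
  by move=> A /andP[_ iA]; rewrite finset.setD1K.
rewrite /b -sumrN; apply: eq_big => [A|A].
  apply/andP/idP=> [[/andP[/fintype.subsetP As _] /eqP iA]|/fintype.subsetP As].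
    apply/fintype.subsetP => x xA; have := As x; rewrite !inE xA orbT => /(_ isT).
    by move: xA; rewrite -iA !inE => /andP[/negPf -> _].
  have iA : i \notin A by apply: contra si => /As; rewrite inE.
  rewrite setU11 finset.setU1K // andbT; split=> //.
  by apply/fintype.subsetP => x; rewrite !inE => /orP[->//|/As]; rewrite inE => ->; rewrite orbT.
move=> /andP[_ /eqP iA]; have {}iA : i \notin A by rewrite -iA !inE eqxx.
rewrite cardsU1 iA add1n exprS mulN1r mulNr; congr (- (_ * _)).
by rewrite finset.setUA [S :|: _]finset.setUC.
Qed.

(** Every point has a neighborhood inside a single member of the cover, so the chains
    subordinate to the cover compute the homology of [T], and their Euler
    characteristic is given by inclusion-exclusion. *)
Theorem nerve_euler_characteristic :
  @is_euler_characteristic R T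
    (- \sum_(S : {set I} | (S != finset.set0) && K S) (-1) ^+ #|S|).
Proof.
have -> : - \sum_(S : {set I} | (S != finset.set0) && K S) (-1) ^+ #|S| =
    incl_excl finset.set0 (enum I).
  rewrite incl_exclE ?enum_uniq // [in RHS](bigD1 finset.set0) ?finset.sub0set //=.
  rewrite finset.setU0 cards0 expr0 mul1r opprD addrA subrr add0r; congr (- _).
  rewrite big_mkcondr /=; apply: eq_big => [S|S _].
    suff -> : S \subset [set:: enum I] by [].
    by apply/fintype.subsetP => x _; rewrite inE mem_enum.
  by rewrite finset.set0U; case: (K S); rewrite ?mulr1 ?mulr0.
apply: (@has_euler_is_euler _ _ (covered finset.set0 (enum I))).
- exact: covered_downward.
- move=> x; have [i Uix] := U_cover x; exists (U i); split=> //.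
  split; first by move=> y _ j; rewrite inE.
  by exists i => //; rewrite mem_enum.
- exact: has_euler_covered.
Qed.

End Nerve.

(** * Barycentric coordinates *)

Section Pairing.
Variable R : realType.
Local Notation D := (std_simplex R).

(** The value at [t] of the affine function with vertex values [v].  These values
    determine [t] and transform simply under simplicial maps; indexing [v] by natural
    numbers avoids transporting ordinals between dimensions. *)
Definition pairing n (t : D n) (v : nat -> R) : R := \sum_i bary t i * v i.

Lemma pairing_inj n (t u : D n) : pairing t =1 pairing u -> t = u.
Proof.
move=> tu; apply: bary_inj => i; have := tu (fun k => (k == i)%:R).
have E w : pairing w (fun k => (k == i :> nat)%:R) = bary w i :> R.
  rewrite /pairing (bigD1 i) //= eqxx mulr1 big1 ?addr0 // => j ji.
  by rewrite (negPf ji : (j == i :> nat) = false) mulr0.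
by rewrite !E.
Qed.

Lemma pairing_eq n (t : D n) v w : (forall k, (k <= n)%N -> v k = w k) ->
  pairing t v = pairing t w.
Proof. by move=> vw; apply: eq_bigr => i _; rewrite vw // -ltnS. Qed.

Lemma pairing_map m n (theta : 'I_m.+1 -> 'I_n.+1) (t : D m) v :
  pairing (simplex_map theta t) v = pairing t (fun k => v (theta (inord k))).
Proof.
rewrite /pairing (partition_big theta predT) //=; apply: eq_bigr => j _.
rewrite /bary /= /push_coord mxE mulr_suml; apply: eq_bigr => i /eqP ij.
by rewrite inord_val ij.
Qed.

Lemma pairing_map_nat m n (theta : 'I_m.+1 -> 'I_n.+1) (f : nat -> nat) (t : D m) v :
  (forall i, theta i = f i :> nat) ->
  pairing (simplex_map theta t) v = pairing t (v \o f).
Proof.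
by move=> tf; rewrite pairing_map; apply: pairing_eq => k kn; rewrite tf inordK.
Qed.

Lemma pairing_continuous n v : continuous (fun t : D n => pairing t v).
Proof.
move=> t; apply: continuous_big => [|i _]; first exact: add_continuous.
by move=> u; apply: (@cvgM _ _ _ (nbhs_filter u)); [exact: bary_continuous|exact: cvg_cst].
Qed.

End Pairing.

Section QuotientHomotopy.
Variables (R : realType) (T Z : topologicalType) (Q0 : quotType T).
Local Notation Q := (quotient_topology Q0).
Variables (H : T -> R -> Z) (h : Q * R -> Z) (W : set Q).
Hypothesis oW : open W.
Hypothesis hH : forall a, W (\pi_Q a) -> forall l, h (\pi_Q a, l) = H a l.
Hypothesis cH : forall a l, W (\pi_Q a) -> {for (a, l), continuous (fun al => H al.1 al.2)}.

(** Local compactness of the line is what makes the product with a quotient map behave: the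
    points whose whole path over a compact time interval stays in an open set form an open
    set upstairs, by the tube lemma, hence also in the quotient. *)
Lemma quotient_homotopy_continuous z l : W z -> {for (z, l), continuous h}.
Proof.
rewrite -[z]reprK; set a0 := repr z => Wa0 O; rewrite hH // => O0.
rewrite nbhs_simpl /=; move: O0; rewrite nbhsE => -[O' [oO' O'0] sO'].
have cHa a l' : W (\pi_Q a) -> O' (H a l') ->
    \forall a' \near a & l'' \near l', O' (H a' l'').
  by move=> Wa Ol; apply: (cH (l := l') Wa); exact: open_nbhs_nbhs.
have [J [Jc Jn JO]] : exists J : set R, [/\ compact J, nbhs l J & forall l', J l' -> O' (H a0 l')].
  have [[A B] /= [A0 Bl] AB] := cHa _ _ Wa0 O'0.
  move/nbhs_ballP : Bl => [e /= e0 eB].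
  exists `[l - e / 2, l + e / 2]%classic; split; first exact: segment_compact.
    apply/nbhs_ballP; exists (e / 2); first by rewrite /= divr_gt0.
    by move=> l'; rewrite /ball /= ltr_norml in_itv /= => /andP[l1 l2]; apply/andP; split; lra.
  move=> l' /= ll'; apply: (AB (a0, l')); split => /=; first exact: nbhs_singleton.
  apply: eB; rewrite /ball /=; move: ll'; rewrite in_itv /= => /andP[l1 l2].
  rewrite ltr_norml; lra.
pose V := [set z' | W z' /\ forall l', J l' -> O' (h (z', l'))].
have oV : open V.
  rewrite /open /= /quotient_open openE => a [/= Wa Ha].
  have near1 : \forall a' \near a, W (\pi_Q a').
    by apply: open_nbhs_nbhs; split=> //; exact: (oW : open (\pi_Q @^-1` W)).
  have /compact_near_coveringP cpt := Jc.
  have : \forall a' \near a, J `<=` fun l' => O' (H a' l').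
    apply: (cpt _ (nbhs a) (fun a' l' => O' (H a' l')) _) => l' Jl'.
    have := cHa a l' Wa; rewrite -hH // => /(_ (Ha _ Jl')) [[A B] /= [Aa Bl] AB].
    by exists (B, A) => //= -[u v] /= [Bu Av]; exact: (AB (v, u)).
  move=> near2; near=> a'; have Wa' : W (\pi_Q a') by near: a'.
  split=> // l' Jl'; rewrite hH //.
  have : J `<=` fun l' => O' (H a' l') by near: a'.
  exact.
exists (V, J); first split => //=.
  by apply: open_nbhs_nbhs; split=> //; split=> // l' Jl'; rewrite hH //; exact: JO.
by move=> [z' l'] /= [[_ Vz'] Jl']; apply: sO'; exact: Vz'.
Unshelve. all: by end_near. Qed.

End QuotientHomotopy.

(** * The simplicial set in vertex coordinates *)

Section VertexCoordinates.
Variable gT : finGroupType.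

(** Vertices are given by a function on all natural numbers, of which only the values up
    to [n] count, so that tuples can be reindexed without dimension constraints. *)
Definition of_vertices n (x : nat -> gT) : {ffun 'I_n.+1 -> gT} :=
  [ffun k : 'I_n.+1 => if k == ord0 then x 0 else ((x k.-1)^-1 * x k)%g].

Fixpoint vertex_of n (g : {ffun 'I_n.+1 -> gT}) (k : nat) : gT :=
  if k is k'.+1 then (vertex_of g k' * g (inord k))%g else g ord0.

Lemma vertex_ofK n (g : {ffun 'I_n.+1 -> gT}) : of_vertices n (vertex_of g) = g.
Proof.
apply/ffunP => k; rewrite ffunE; have [->//|k0] := eqVneq k ord0.
have kE : k = k.-1.+1 :> nat by rewrite prednK // lt0n.
by rewrite {2}kE /= mulKg -kE inord_val.
Qed.

Lemma of_vertices_eq n x y : (forall k, (k <= n)%N -> x k = y k) ->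
  of_vertices n x = of_vertices n y.
Proof.
move=> xy; apply/ffunP => k; rewrite !ffunE xy //.
have kn : (k <= n)%N by rewrite -ltnS.
by rewrite !xy // (leq_trans (leq_pred _)).
Qed.

Definition vertex_set n (x : nat -> gT) : {set gT} := [set x (val k) | k : 'I_n.+1].

Lemma vertex_set_mem n x k : (k <= n)%N -> x k \in vertex_set n x.
Proof. by move=> kn; apply/imsetP; exists (inord k) => //=; rewrite inordK. Qed.

Lemma face_of_vertices n (i : 'I_n.+2) x :
  E_face_fun i (of_vertices n.+1 x) = of_vertices n (x \o bump i).
Proof.
apply/ffunP => k; rewrite !ffunE -!val_eqE /=.
have kn := ltn_ord k; have i_n := ltn_ord i.
rewrite !inordK; try lia.
case: k kn => [[|k] kn'] /= kn; rewrite /bump.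
  case: ifP => i0 /=; first by rewrite leqNgt i0.
  have -> : (i : nat) = 0%N by lia.
  by rewrite eqxx mulKVg.
case: ltnP => ki /=.
  by have -> : (i <= k)%N = false by lia.
case: eqP => kE /=; last by have -> : (i <= k)%N by lia.
have -> : (i <= k)%N = false by lia.
by rewrite mulgA mulgK.
Qed.

Lemma degen_of_vertices n (j : 'I_n.+1) x :
  E_degen_fun j (of_vertices n x) = of_vertices n.+1 (x \o unbump j).
Proof.
apply/ffunP => k; rewrite !ffunE -!val_eqE /=.
have kn := ltn_ord k; have jn := ltn_ord j; rewrite /unbump.
case: k kn => [[|k] kn'] /= kn; first by rewrite inordK.
case: (ltngtP k j) => [kj|jk|kj] /=.
- have jk : (j < k.+1)%N = false by lia.
  by rewrite inordK ?jk ?subn0 //; lia.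
- have jk1 : (j < k.+1)%N by lia.
  rewrite inordK // eqSS (gtn_eqF jk) jk1.
  by case: k kn' kn jk jk1 => // k _ _ _ _; rewrite /= !subn1.
- by rewrite kj eqxx ltnSn subn0 subn1 mulVg.
Qed.

End VertexCoordinates.

Section Cosets.
Variables (gT : finGroupType) (q : nat) (G : {group gT}).
Hypothesis hG : ('L_q(G) != 1)%g.

(** The simplices of the underlying simplicial complex. *)
Definition in_coset (S : {set gT}) : bool :=
  [exists H in Nq q G, [exists y in G, S \subset (y *: (H : {group gT}))%g]].

(** The quotients of consecutive vertices generate the smallest subgroup having a coset
    that contains all the vertices.  If its term ['L_q] of the lower central series is
    trivial then it is proper, since ['L_q(G)] is not trivial. *)
Lemma E_cond_in_coset n x : E_cond q G (of_vertices n x) = in_coset (vertex_set n x).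
Proof.
have gk k : (k < n)%N -> of_vertices n x (inord k.+1) = ((x k)^-1 * x k.+1)%g.
  by move=> kn; rewrite ffunE -val_eqE /= inordK.
apply/idP/idP.
  move=> /andP[/forallP gG Lg].
  pose H := <<[set of_vertices n x i | i : 'I_n.+1 & i != ord0]>>%G.
  have HG : H \subset G.
    by rewrite gen_subG; apply/fintype.subsetP => _ /imsetP[i _ ->].
  apply/exists_inP; exists H.
    rewrite inE Lg andbT finset.properEneq HG andbT; apply: contra hG => /eqP HE.
    by rewrite -HE.
  have x0G : x 0%N \in G by have := gG ord0; rewrite ffunE.
  apply/exists_inP; exists (x 0%N) => //.
  apply/fintype.subsetP => _ /imsetP[k _ ->]; rewrite mem_lcoset.
  have : (val k <= n)%N by rewrite -ltnS; exact: ltn_ord k.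
  elim: (val k) => [|m IH] mn; first by rewrite mulVg group1.
  rewrite -(mulKVg (x m) (x m.+1)) mulgA groupM ?IH ?(ltnW mn) //.
  rewrite -gk //; apply/mem_gen/imset_f; rewrite inE -val_eqE /= inordK //.
move=> /exists_inP[H]; rewrite inE => /andP[HG LH] /exists_inP[y yG /fintype.subsetP xH].
have xHk k : (k <= n)%N -> (y^-1 * x k)%g \in H.
  by move=> kn; rewrite -mem_lcoset; apply: xH; exact: vertex_set_mem.
have HG' := fintype.subsetP (proper_sub HG).
have gH k : k != ord0 -> of_vertices n x k \in H.
  move=> k0; rewrite ffunE (negPf k0).
  have kn : (k <= n)%N by rewrite -ltnS; exact: ltn_ord k.
  have -> : ((x k.-1)^-1 * x k = (y^-1 * x k.-1)^-1 * (y^-1 * x k))%g.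
    by rewrite invMg invgK mulgA mulgK.
  by rewrite groupM ?groupV ?xHk // (leq_trans (leq_pred _)).
apply/andP; split.
  apply/forallP => k; have [->|k0] := eqVneq k ord0; last by apply: HG'; exact: gH.
  by rewrite ffunE eqxx -(mulKVg y (x 0%N)) groupM // HG' // xHk.
rewrite -subG1 -(eqP LH); apply: lcnS.
by rewrite gen_subG; apply/fintype.subsetP => _ /imsetP[k + ->]; rewrite inE; exact: gH.
Qed.

Lemma in_cosetS (S S' : {set gT}) : S \subset S' -> in_coset S' -> in_coset S.
Proof.
move=> SS' /exists_inP[H NH /exists_inP[y yG yH]]; apply/exists_inP; exists H => //.
by apply/exists_inP; exists y => //; exact: fintype.subset_trans yH.
Qed.

End Cosets.

Section Realization.
Variables (R : realType) (gT : finGroupType) (q : nat) (G : {group gT}).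
Local Notation D := (std_simplex R).
Local Notation X := (E_sset q G).
Local Notation Esp := (E_space q G R).
Local Notation pre := (pre_realization R X).

Definition pi_E (a : pre) : Esp := \pi_Esp a.

Lemma E_cond_trivial : E_cond q G (of_vertices 0 (fun=> 1%g)).
Proof.
apply/andP; split; first by apply/forallP => k; rewrite ffunE; case: eqP => _; rewrite ?mulVg group1.
set gens := (X in <<X>>%g); have -> : gens = finset.set0.
  by apply/setP => y; rewrite inE; apply/imsetP => -[k]; rewrite inE (ord1 k).
by rewrite gen0 -subG1; exact: lcn_sub.
Qed.

Definition E_mk n (x : nat -> gT) (h : E_cond q G (of_vertices n x)) : E_simplex q G n :=
  exist (fun g => E_cond q G g) _ h.

Definition base_simplex : X 0 := E_mk E_cond_trivial.

(** Made total, with a junk value when [x] does not span a simplex, so that points can be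
    compared without carrying proofs. *)
Definition E_point n (x : nat -> gT) (t : D n) : Esp :=
  if insub (of_vertices n x) is Some g then pi_E (@pre_pt R X n g t)
  else pi_E (@pre_pt R X 0 base_simplex (vertex R ord0)).

Lemma E_pointE n x t (h : E_cond q G (of_vertices n x)) :
  E_point x t = pi_E (@pre_pt R X n (E_mk h) t).
Proof.
rewrite /E_point insubT /=; congr (pi_E (pre_pt _ _)); exact: val_inj.
Qed.

Lemma E_point_eq n x y (t : D n) : (forall k, (k <= n)%N -> x k = y k) -> E_point x t = E_point y t.
Proof. by move=> xy; rewrite /E_point (of_vertices_eq xy). Qed.

Lemma E_point_continuous n x : continuous (@E_point n x).
Proof.
have [h|h] := boolP (E_cond q G (of_vertices n x)); last first.
  have -> : @E_point n x = cst (pi_E (@pre_pt R X 0 base_simplex (vertex R ord0))).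
    by apply/funext => t; rewrite /E_point insubN.
  exact: cst_continuous.
have -> : @E_point n x = (fun t => pi_E (@pre_pt R X n (E_mk h) t)).
  by apply/funext => t; exact: E_pointE.
move=> t; apply: (@continuous_comp _ _ _ (fun t => @pre_pt R X n (E_mk h) t) pi_E).
  exact: existT_continuous.
exact: pi_continuous.
Qed.

Lemma pi_E_glue a b : glue_step a b -> pi_E a = pi_E b.
Proof.
move=> ab; apply/eqmodP/asboolP; exact: Relation_Operators.rst_step.
Qed.

(** In vertex coordinates the gluing rules reindex the vertices, by [bump] and [unbump]. *)
Lemma E_point_face n (i : 'I_n.+2) x (t : D n) : E_cond q G (of_vertices n.+1 x) ->
  E_point (x \o bump i) t = E_point x (coface R i t).
Proof.
move=> h; rewrite (E_pointE _ h).
have h' := E_face_cond i h; have h'' := h'; rewrite face_of_vertices in h''.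
rewrite (E_pointE _ h'') -(pi_E_glue (glue_face i (E_mk h : X n.+1) t)).
congr (pi_E (pre_pt _ _)); apply: val_inj; by rewrite /= face_of_vertices.
Qed.

Lemma E_point_degen n (j : 'I_n.+1) x (t : D n.+1) : E_cond q G (of_vertices n x) ->
  E_point (x \o unbump j) t = E_point x (codegen R j t).
Proof.
move=> h; rewrite (E_pointE _ h).
have h' := E_degen_cond j h; have h'' := h'; rewrite degen_of_vertices in h''.
rewrite (E_pointE _ h'') -(pi_E_glue (glue_degen j (E_mk h : X n) t)).
congr (pi_E (pre_pt _ _)); apply: val_inj; by rewrite /= degen_of_vertices.
Qed.

End Realization.

(** * Stars of vertices *)

Section JoinWeights.
Variables (R : realType) (n m : nat).
Hypothesis m_gt0 : (0 < m)%N.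
Local Notation D := (std_simplex R).
Variables (t : D n) (l : R).

(** Coordinates in the join of [t] with a simplex having [m] vertices: at time [l] the mass
    [clamp l] has moved to the second factor, evenly spread. *)
Definition join_weight (k : nat) : R :=
  if (k < n.+1)%N then (1 - clamp l) * bary t (inord k) else clamp l / m%:R.

Lemma join_weight_ge0 (k : 'I_(n + m).+1) : 0 <= join_weight k.
Proof.
rewrite /join_weight; case: ifP => _.
  by rewrite mulr_ge0 ?bary_ge0 // subr_ge0 clamp_le1.
by rewrite divr_ge0 ?clamp_ge0.
Qed.

Lemma join_weight_pairing (v : nat -> R) :
  \sum_(k < (n + m).+1) join_weight k * v k =
  (1 - clamp l) * pairing t v + clamp l / m%:R * \sum_(0 <= r < m) v (n.+1 + r)%N.
Proof.
rewrite big_mkord -[LHS]/(\sum_(k < n.+1 + m) join_weight k * v k) big_split_ord /=.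
rewrite !mulr_sumr; congr (_ + _); apply: eq_bigr => k _.
  by rewrite /join_weight /= ltn_ord inord_val mulrA.
by rewrite /join_weight /= ltnNge leq_addr.
Qed.

Lemma join_weight_sum : \sum_(k < (n + m).+1) join_weight k = 1.
Proof.
under eq_bigr do rewrite -[join_weight _]mulr1.
rewrite (join_weight_pairing (fun=> 1)) /pairing.
under eq_bigr do rewrite mulr1.
rewrite bary_sum sumr_const_nat subn0 divfK ?pnatr_eq0 -?lt0n //; ring.
Qed.

Definition join_bary : D (n + m) := mk_simplex join_weight_ge0 join_weight_sum.

Lemma pairing_join v : pairing join_bary v =
  (1 - clamp l) * pairing t v + clamp l / m%:R * \sum_(0 <= r < m) v (n.+1 + r)%N.
Proof.
rewrite -join_weight_pairing; apply: eq_bigr => k _; by rewrite bary_mk.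
Qed.

End JoinWeights.

Lemma join_bary_continuous (R : realType) n m (m_gt0 : (0 < m)%N) :
  continuous (fun tl : std_simplex R n * R => join_bary m_gt0 tl.1 tl.2).
Proof.
move=> tl; apply: (@simplex_cvg _ _ (nbhs tl) _) => k.
rewrite bary_mk.
have -> : (fun z => bary (join_bary m_gt0 z.1 z.2) k) =
    (fun z : std_simplex R n * R => join_weight m z.1 z.2 k).
  by apply/funext => z; rewrite bary_mk.
have cl : (fun zl : std_simplex R n * R => clamp zl.2) @ nbhs tl --> clamp tl.2.
  apply: (@continuous_comp _ _ _ snd (@clamp R)); [exact: cvg_snd|exact: clamp_continuous].
rewrite /join_weight; case: ifP => _.
  apply: (@cvgM _ _ _ (nbhs_filter tl)).
    by apply: (@cvgB _ _ _ _ (nbhs_filter tl)) => //; exact: cvg_cst.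
  apply: (@continuous_comp _ _ _ fst (fun z => bary z _)); [exact: cvg_fst|exact: bary_continuous].
by apply: (@cvgM _ _ _ (nbhs_filter tl)) => //; exact: cvg_cst.
Qed.

Section Stars.
Variables (R : realType) (gT : finGroupType) (q : nat) (G : {group gT}).
Local Notation D := (std_simplex R).
Local Notation X := (E_sset q G).
Local Notation Esp := (E_space q G R).
Local Notation pre := (pre_realization R X).

Lemma vertex_of_of_vertices n (x : nat -> gT) k : (k <= n)%N ->
  vertex_of (of_vertices n x) k = x k.
Proof.
elim: k => [|k IH] kn /=; first by rewrite ffunE.
by rewrite IH ?(ltnW kn) // ffunE -val_eqE /= inordK //= mulKVg.
Qed.

Lemma vertex_of_face n (i : 'I_n.+2) (g : {ffun 'I_n.+2 -> gT}) k : (k <= n)%N ->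
  vertex_of (E_face_fun i g) k = vertex_of g (bump i k).
Proof.
by move=> kn; rewrite -{1}(vertex_ofK g) face_of_vertices vertex_of_of_vertices.
Qed.

Lemma vertex_of_degen n (j : 'I_n.+1) (g : {ffun 'I_n.+1 -> gT}) k : (k <= n.+1)%N ->
  vertex_of (E_degen_fun j g) k = vertex_of g (unbump j k).
Proof.
by move=> kn; rewrite -{1}(vertex_ofK g) degen_of_vertices vertex_of_of_vertices.
Qed.

Definition pre_dim (p : pre) : nat := projT1 (projT1 p).
Definition pre_vertex (p : pre) : nat -> gT := vertex_of (val (projT2 (projT1 p))).
Definition pre_bary (p : pre) : D (pre_dim p) := projT2 p.

Definition pre_coord (a : gT) (p : pre) : R :=
  pairing (pre_bary p) (fun k => (pre_vertex p k == a)%:R).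

Lemma pairing_coface n (i : 'I_n.+2) (t : D n) v :
  pairing (coface R i t) v = pairing t (v \o bump i).
Proof. exact: pairing_map_nat. Qed.

Lemma pairing_codegen n (j : 'I_n.+1) (t : D n.+1) v :
  pairing (codegen R j t) v = pairing t (v \o unbump j).
Proof.
apply: pairing_map_nat => k; rewrite inordK //.
have := ltn_ord k; have := ltn_ord j; rewrite /unbump; lia.
Qed.

(** Degenerate simplices have repeated vertices, whose masses add up. *)
Lemma pre_coord_glue a p p' : glue_step p p' -> pre_coord a p = pre_coord a p'.
Proof.
case=> [n i g t|n j g t]; rewrite /pre_coord /pre_bary /pre_vertex /=.
  rewrite pairing_coface; apply: pairing_eq => k kn /=; by rewrite vertex_of_face.
rewrite pairing_codegen; apply: pairing_eq => k kn /=; by rewrite vertex_of_degen.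
Qed.

Definition pre_star (S : {set gT}) (p : pre) := forall a, a \in S -> 0 < pre_coord a p.

(** A function on the disjoint union of simplices descends to an intersection of stars if
    it respects the generating identifications there, because membership in the stars is
    preserved along a chain of identifications. *)
Lemma glue_ind (A : Type) (f : pre -> A) S :
  (forall p p', glue_step p p' -> pre_star S p -> f p = f p') ->
  forall p p', pi_E p = pi_E p' -> pre_star S p -> f p = f p'.
Proof.
move=> fg p p' /eqmodP/asboolP pp'.
suff [] : (pre_star S p <-> pre_star S p') /\ (pre_star S p -> f p = f p') by [].
elim: pp' => [{}p {}p' st|{}p|{}p {}p' _ [IH1 IH2]|{}p p1 {}p' _ [IH1 IH2] _ [IH3 IH4]].
- split; last exact: fg.
  by split=> ps a /ps; rewrite (pre_coord_glue a st).
- by [].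
- split; first by split=> /IH1.
  by move=> /IH1 ps; rewrite IH2.
- split; first by split=> [/IH1/IH3|/IH3/IH1].
  by move=> ps; rewrite IH2 // IH4 //; apply/IH1.
Qed.

Definition coord (a : gT) (z : Esp) : R := pre_coord a (repr z).

Lemma coord_pi a p : coord a (pi_E p) = pre_coord a p.
Proof.
apply: (@glue_ind _ (pre_coord a) finset.set0); last by move=> ?; rewrite inE.
- by move=> p1 p2 /pre_coord_glue.
- by rewrite /pi_E reprK.
Qed.

Definition star (a : gT) : set Esp := [set z | 0 < coord a z].

Lemma star_open a : open (star a).
Proof.
rewrite /open /= /quotient_open; apply/sigT_openP => -[n g].
rewrite (_ : _ @^-1` _ = (fun t : D n => pairing t (fun k => (vertex_of (val g) k == a)%:R))
    @^-1` [set y | 0 < y]).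
  by apply: open_comp; [move=> t _; exact: pairing_continuous|exact: open_gt].
apply/seteqP; split=> t /=; rewrite /star /=;
  by rewrite -[\pi_(_) _]/(pi_E (@pre_pt R X n g t)) coord_pi.
Qed.

Lemma pre_eq (p : pre) : p = @pre_pt R X (pre_dim p) (projT2 (projT1 p)) (pre_bary p).
Proof. by case: p => [[n g] t]. Qed.

Lemma E_cond_pre (p : pre) : E_cond q G (of_vertices (pre_dim p) (pre_vertex p)).
Proof. by rewrite vertex_ofK; exact: valP. Qed.

Lemma pi_E_E_point (p : pre) : pi_E p = E_point q G (pre_vertex p) (pre_bary p).
Proof.
rewrite (E_pointE _ (E_cond_pre p)) {1}(pre_eq p); congr (pi_E (pre_pt _ _)).
by apply: val_inj; rewrite /= vertex_ofK.
Qed.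

Lemma coord_E_point n x (t : D n) a : E_cond q G (of_vertices n x) ->
  coord a (E_point q G x t) = pairing t (fun k => (x k == a)%:R).
Proof.
move=> h; rewrite (E_pointE _ h) coord_pi; apply: pairing_eq => k kn.
by rewrite /pre_vertex /= vertex_of_of_vertices.
Qed.

Lemma pi_E_surj (z : Esp) : exists p, z = pi_E p.
Proof. by exists (repr z); rewrite /pi_E reprK. Qed.

Lemma star_cover (z : Esp) : exists a, star a z.
Proof.
have [p ->] := pi_E_surj z.
have [k k0] : exists k, 0 < bary (pre_bary p) k.
  apply/not_existsP => H; have := bary_sum (pre_bary p).
  rewrite big1 => [/esym/eqP|k _]; first by rewrite oner_eq0.
  by apply/eqP; rewrite eq_le bary_ge0 andbT leNgt; apply/negP/H.
exists (pre_vertex p k); rewrite /star /= coord_pi /pre_coord /pairing.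
rewrite (bigD1 k) //= eqxx mulr1 ltr_wpDr //.
by apply: sumr_ge0 => j _; rewrite mulr_ge0 ?bary_ge0.
Qed.

Lemma pre_coord_vertex a p : 0 < pre_coord a p -> a \in vertex_set (pre_dim p) (pre_vertex p).
Proof.
apply: contraTT => aN; rewrite -leNgt /pre_coord /pairing big1 // => k _.
case: eqP => [E|_]; last by rewrite mulr0.
by case/negP: aN; apply/imsetP; exists k.
Qed.

Lemma pre_star_vertices S p : pre_star S p ->
  S \subset vertex_set (pre_dim p) (pre_vertex p).
Proof. by move=> ps; apply/fintype.subsetP => a /ps; exact: pre_coord_vertex. Qed.

Lemma common_pi S p : common star S (pi_E p) <-> pre_star S p.
Proof. by split=> H a /H; rewrite /star /= coord_pi. Qed.

(** A point in the stars of all elements of [S] lies in a simplex having these elements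
    among its vertices. *)
Lemma star_empty (S : {set gT}) : ('L_q(G) != 1)%g -> ~~ in_coset q G S -> forall z, ~ common star S z.
Proof.
move=> hG SN z; have [p ->] := pi_E_surj z; move/common_pi/pre_star_vertices => Sp.
case/negP: SN; apply: in_cosetS Sp _; rewrite -E_cond_in_coset //; exact: E_cond_pre.
Qed.

End Stars.

(** * Contraction of an intersection of stars *)

Section StarContraction.
Variables (R : realType) (gT : finGroupType) (q : nat) (G : {group gT}).
Hypothesis hG : ('L_q(G) != 1)%g.
Local Notation D := (std_simplex R).
Local Notation X := (E_sset q G).
Local Notation Esp := (E_space q G R).
Local Notation pre := (pre_realization R X).
Local Notation E_point := (@E_point R gT q G _).

Lemma E_cond_vertex_subset n N x y : vertex_set n x \subset vertex_set N y ->
  E_cond q G (of_vertices N y) -> E_cond q G (of_vertices n x).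
Proof. by rewrite !E_cond_in_coset //; exact: in_cosetS. Qed.

Lemma vertex_set_sub n (x : nat -> gT) (S : {set gT}) :
  (forall k, (k <= n)%N -> x k \in S) -> vertex_set n x \subset S.
Proof.
move=> xS; apply/fintype.subsetP => _ /imsetP[k _ ->]; apply: xS.
by have := ltn_ord k; rewrite ltnS.
Qed.

(** At time 0 the vertices from [S] have weight zero and can be removed as last faces. *)
Lemma E_point_drop_last N n (t : D n) (u : D N) x : (n <= N)%N ->
  pairing u =1 pairing t -> E_cond q G (of_vertices N x) -> E_point x u = E_point x t.
Proof.
elim: N u => [|N IH] u nN ut h.
  have n0 : n = 0%N by lia.
  by subst n; congr (E_point _ _); exact: pairing_inj.
have [E|nN'] := eqVneq n N.+1.
  by subst n; congr (E_point _ _); exact: pairing_inj.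
have {}nN : (n <= N)%N by lia.
pose u' : D N := simplex_map (fun k : 'I_n.+1 => inord k) t.
have u't : pairing u' =1 pairing t.
  move=> v; apply: (pairing_map_nat (f := id)) => k; rewrite inordK //.
  by have := ltn_ord k; lia.
have bE k : (k <= N)%N -> bump (ord_max : 'I_N.+2) k = k.
  by move=> kN; rewrite /bump /= leqNgt ltnS kN.
have h' : E_cond q G (of_vertices N x).
  apply: E_cond_vertex_subset h; apply: vertex_set_sub => k kN; apply: vertex_set_mem.
  exact: leqW.
have -> : u = coface R ord_max u'.
  apply: pairing_inj => v; rewrite pairing_coface ut -u't; apply: pairing_eq => k kN /=.
  by rewrite bE.
rewrite -E_point_face // -(IH u') //; apply: E_point_eq => k kN /=; by rewrite bE.
Qed.

(** At time 1 the original vertices have weight zero and can be removed as first faces. *)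
Lemma E_point_drop_first a N N' (t : D N) (u : D N') x : N' = (a + N)%N ->
  (forall v, pairing u v = pairing t (v \o addn a)) ->
  E_cond q G (of_vertices N' x) -> E_point x u = E_point (x \o addn a) t.
Proof.
elim: a N' u x => [|a IH] N' u x NE ut h.
  subst N'; congr (E_point _ _); apply: pairing_inj => v; exact: ut.
subst N'; pose u' : D (a + N) := simplex_map (fun k : 'I_N.+1 => inord (a + k)) t.
have u't v : pairing u' v = pairing t (v \o addn a).
  apply: pairing_map_nat => k; rewrite inordK //.
  by have := ltn_ord k; lia.
have bE k : bump (ord0 : 'I_(a + N).+2) k = k.+1 by [].
have -> : u = coface R ord0 u'.
  by apply: pairing_inj => v; rewrite pairing_coface ut u't; apply: pairing_eq => k kN.
rewrite -E_point_face // (IH _ u') //.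
apply: E_cond_vertex_subset h; apply: vertex_set_sub => k kN; rewrite /= bE.
exact: vertex_set_mem.
Qed.

Variable S : {set gT}.
Hypotheses (S0 : S != finset.set0) (KS : in_coset q G S).

Let m := #|S|.
Let s (k : nat) : gT := nth 1%g (enum S) k.

Lemma card_S_gt0 : (0 < m)%N. Proof. by rewrite card_gt0. Qed.

Lemma nth_S_mem k : (k < m)%N -> s k \in S.
Proof. by move=> km; rewrite -mem_enum; apply: mem_nth; rewrite -cardE. Qed.

Lemma nth_S_surj a : a \in S -> exists2 k, (k < m)%N & s k = a.
Proof.
move=> aS; exists (index a (enum S)); first by rewrite /m cardE index_mem mem_enum.
by rewrite /s nth_index // mem_enum.
Qed.

Definition join_vertices n (x : nat -> gT) (k : nat) : gT :=
  if (k < n.+1)%N then x k else s (k - n.+1).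

Lemma join_vertices_last n x r : join_vertices n x (n.+1 + r) = s r.
Proof. by rewrite /join_vertices ltnNge leq_addr /= addKn. Qed.

Lemma join_vertices_first n x k : (k <= n)%N -> join_vertices n x k = x k.
Proof. by move=> kn; rewrite /join_vertices ltnS kn. Qed.

Lemma join_vertex_set n x : vertex_set (n + m) (join_vertices n x) \subset vertex_set n x :|: S.
Proof.
apply: vertex_set_sub => k kn; rewrite inE /join_vertices; case: ltnP => kn'.
  by rewrite vertex_set_mem.
by rewrite nth_S_mem ?orbT //; lia.
Qed.

(** In the intersection of the stars, joining with [S] adds no vertex that was not there,
    which is why the join is again a simplex. *)
Lemma E_cond_join (p : pre) : pre_star S p ->
  E_cond q G (of_vertices (pre_dim p + m) (join_vertices (pre_dim p) (pre_vertex p))).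
Proof.
move=> Sp; rewrite E_cond_in_coset //; apply: in_cosetS (join_vertex_set _ _) _.
rewrite (finset.setUidPl (pre_star_vertices Sp)) -E_cond_in_coset //; exact: E_cond_pre.
Qed.

Definition pre_contract (p : pre) (l : R) : Esp :=
  E_point (join_vertices (pre_dim p) (pre_vertex p)) (join_bary card_S_gt0 (pre_bary p) l).

Lemma pre_star_glue (p p' : pre) : glue_step p p' -> pre_star S p <-> pre_star S p'.
Proof. by move=> st; split=> ps a /ps; rewrite (pre_coord_glue a st). Qed.

(** Joining with a fixed simplex commutes with the simplicial operations on the first
    factor, which keep their indices. *)
Lemma pre_contract_glue p p' l : glue_step p p' -> pre_star S p ->
  pre_contract p l = pre_contract p' l.
Proof.
move=> st ps; have ps' := (pre_star_glue st).1 ps.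
have h := E_cond_join ps; have h' := E_cond_join ps'.
case: st ps ps' h h' => [n i g t|n j g t] ps ps' h h'.
  rewrite /pre_contract /pre_dim /pre_bary /=.
  have i_n := ltn_ord i.
  have iE : (inord i : 'I_(n + m).+2) = i :> nat by rewrite inordK //; lia.
  have -> : join_bary card_S_gt0 (coface R i t) l = coface R (inord i) (join_bary card_S_gt0 t l).
    apply: pairing_inj => v; rewrite pairing_coface !pairing_join pairing_coface iE.
    congr (_ + _); congr (_ * _); apply: eq_big_nat => r _ /=.
    by congr (v _); rewrite /bump; lia.
  rewrite -[RHS]E_point_face; last exact: h'.
  apply: E_point_eq => k kn /=; rewrite iE; case: (ltnP k n.+1) => kn'.
    rewrite join_vertices_first // join_vertices_first; last by rewrite /bump; lia.
    exact: vertex_of_face.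
  rewrite -(subnKC kn') join_vertices_last.
  have -> : bump i (n.+1 + (k - n.+1)) = (n.+2 + (k - n.+1))%N by rewrite /bump; lia.
  by rewrite join_vertices_last.
rewrite /pre_contract /pre_dim /pre_bary /=.
have jn := ltn_ord j.
have jE : (inord j : 'I_(n + m).+1) = j :> nat by rewrite inordK //; lia.
have -> : join_bary card_S_gt0 (codegen R j t) l = codegen R (inord j) (join_bary card_S_gt0 t l).
  apply: pairing_inj => v; rewrite pairing_codegen !pairing_join pairing_codegen jE.
  rewrite (pairing_join card_S_gt0 t l); congr (_ + _); congr (_ * _); apply: eq_big_nat => r _ /=.
  by congr (v _); rewrite /unbump; lia.
rewrite -[RHS]E_point_degen; last exact: h'.
apply: E_point_eq => k kn /=; rewrite jE; case: (ltnP k n.+2) => kn'.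
  rewrite join_vertices_first // join_vertices_first; last by rewrite /unbump; lia.
  exact: vertex_of_degen.
rewrite -(subnKC kn') join_vertices_last.
have -> : unbump j (n.+2 + (k - n.+2)) = (n.+1 + (k - n.+2))%N by rewrite /unbump; lia.
by rewrite join_vertices_last.
Qed.

Definition star_contract (zl : Esp * R) : Esp := pre_contract (repr zl.1) zl.2.

Lemma star_contract_pi p l : pre_star S p -> star_contract (pi_E p, l) = pre_contract p l.
Proof.
move=> ps; rewrite /star_contract /=; symmetry.
apply: (@glue_ind _ _ _ _ _ (pre_contract^~ l) S) => //; last by rewrite /pi_E reprK.
by move=> p1 p2 st ps1; exact: pre_contract_glue.
Qed.

Definition star_center : Esp := E_point s (barycenter R m.-1).

Lemma E_cond_center : E_cond q G (of_vertices m.-1 s).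
Proof.
rewrite E_cond_in_coset //; apply: in_cosetS KS; apply: vertex_set_sub => k km.
by apply: nth_S_mem; have := card_S_gt0; lia.
Qed.

Lemma pairing_barycenter n v :
  pairing (barycenter R n) v = n.+1%:R^-1 * \sum_(0 <= r < n.+1) v r.
Proof. by rewrite big_mkord mulr_sumr; apply: eq_bigr => k _; rewrite bary_mk. Qed.

Lemma pre_contract0 p : pre_star S p -> pre_contract p 0 = pi_E p.
Proof.
move=> ps; rewrite pi_E_E_point /pre_contract (@E_point_drop_last _ _ (pre_bary p)) ?leq_addr //.
- by apply: E_point_eq => k kn; rewrite join_vertices_first.
- by move=> v; rewrite pairing_join clamp0 mul0r mul0r addr0 subr0 mul1r.
- exact: E_cond_join.
Qed.

Lemma pre_contract1 p : pre_star S p -> pre_contract p 1 = star_center.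
Proof.
move=> ps; have mE : m = m.-1.+1 by rewrite prednK // card_S_gt0.
rewrite /pre_contract (@E_point_drop_first (pre_dim p).+1 m.-1 _ (barycenter R m.-1)).
- by apply: E_point_eq => k kn /=; rewrite join_vertices_last.
- by rewrite {1}mE; lia.
- move=> v; rewrite pairing_join clamp1 subrr mul0r add0r pairing_barycenter -mE.
  by rewrite mul1r.
- exact: E_cond_join.
Qed.

Lemma sum_nth_S_gt0 a : a \in S -> 0 < \sum_(0 <= r < m) (s r == a)%:R :> R.
Proof.
move=> /nth_S_surj[k km <-]; rewrite big_mkord (bigD1 (Ordinal km)) //= eqxx.
by rewrite ltr_wpDr //; apply: sumr_ge0.
Qed.

(** A point never leaves the stars: at times before 1 its own coordinates are positive,
    at time 1 those of the barycenter of [S] are. *)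
Lemma pre_contract_star p l : pre_star S p ->
  common (star (R := R) (q := q) (G := G)) S (pre_contract p l).
Proof.
move=> ps a aS; rewrite /star /= coord_E_point; last exact: E_cond_join.
rewrite pairing_join.
have p0 : 0 < pairing (pre_bary p) (fun k => (join_vertices (pre_dim p) (pre_vertex p) k == a)%:R).
  rewrite (@pairing_eq _ _ _ _ (fun k => (pre_vertex p k == a)%:R)); first exact: (ps a aS).
  by move=> k kn; rewrite join_vertices_first.
have c0 := clamp_ge0 l; have c1 := clamp_le1 l.
have s0 : 0 < \sum_(0 <= r < m)
    (join_vertices (pre_dim p) (pre_vertex p) ((pre_dim p).+1 + r) == a)%:R :> R.
  by under eq_bigr do rewrite join_vertices_last; exact: sum_nth_S_gt0.
have m0 : 0 < (m%:R : R) by rewrite ltr0n card_S_gt0.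
have [cl|cl] := ltP (clamp l) 1.
  apply: ltr_wpDr; last by rewrite mulr_gt0 // subr_gt0.
  by apply: mulr_ge0; [apply: divr_ge0 => //; exact: ltW|exact: ltW].
have -> : clamp l = 1 by apply/eqP; rewrite eq_le c1 cl.
by rewrite subrr mul0r add0r mulr_gt0 // divr_gt0.
Qed.

Lemma star_center_mem : common (star (R := R) (q := q) (G := G)) S star_center.
Proof.
move=> a aS; rewrite /star /= coord_E_point; last exact: E_cond_center.
rewrite pairing_barycenter prednK ?card_S_gt0 // mulr_gt0 ?invr_gt0 ?ltr0n ?card_S_gt0 //.
exact: sum_nth_S_gt0.
Qed.

Lemma common_star_open : open (common (star (R := R) (q := q) (G := G)) S).
Proof.
suff H (r : seq gT) : open [set z | forall a, a \in r -> star (R := R) (q := q) (G := G) a z].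
  rewrite (_ : common _ _ = [set z | forall a, a \in enum S -> star a z]) //.
  by apply/seteqP; split=> z zS a; have := zS a; rewrite mem_enum.
elim: r => [|b r IH].
  by rewrite (_ : [set z | _] = setT); [exact: openT|apply/seteqP; split].
rewrite (_ : [set z | _] = star b `&` [set z | forall a, a \in r -> star a z]).
  by apply: openI => //; exact: star_open.
apply/seteqP; split=> z /=.
  move=> H; split; first by apply: H; rewrite mem_head.
  by move=> a ar; apply: H; rewrite inE ar orbT.
by move=> [zb zr] a; rewrite inE => /orP[/eqP -> //|]; exact: zr.
Qed.

Lemma pre_contract_continuous p l :
  {for (p, l), continuous (fun pl => pre_contract pl.1 pl.2)}.
Proof.
case: p => [[n g] t].
pose f (tl : D n * R) : Esp :=
  E_point (join_vertices n (vertex_of (val g))) (join_bary card_S_gt0 tl.1 tl.2).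
have cf : {for (t, l), continuous f}.
  apply: (@continuous_comp _ _ _ (fun tl : D n * R => join_bary card_S_gt0 tl.1 tl.2)).
    exact: join_bary_continuous.
  exact: E_point_continuous.
move=> O O0; have [[A B] /= [At Bl] AB] := cf O O0.
exists (existT (fun x : simplex_idx X => D (projT1 x) : topologicalType) (existT _ n g) @` A, B).
  by split => //=; exact: existT_nbhs.
by move=> [_ l'] /= [[t' At' <-] Bl']; exact: (AB (t', l')).
Qed.

Lemma star_contracts :
  contracts_to (common (star (R := R) (q := q) (G := G)) S) star_contract star_center.
Proof.
split.
- move=> z l zS _.
  apply: (@quotient_homotopy_continuous R pre Esp _ pre_contract star_contract
    (common (star (R := R) (q := q) (G := G)) S) common_star_open) => //.
    by move=> p /common_pi ps l'; exact: star_contract_pi.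
  by move=> p l' _; exact: pre_contract_continuous.
- move=> z; have [p ->] := pi_E_surj z => /common_pi ps.
  by rewrite star_contract_pi // pre_contract0.
- move=> z; have [p ->] := pi_E_surj z => /common_pi ps.
  by rewrite star_contract_pi // pre_contract1.
- move=> z l; have [p ->] := pi_E_surj z => /common_pi ps _.
  by rewrite star_contract_pi //; exact: pre_contract_star.
Qed.

End StarContraction.

(** * Alternating sums over sets contained in a coset *)

Section DualMoebius.
Variables (gT : finGroupType) (L : {set {group gT}}).
Implicit Types A B U W : {group gT}.
Local Notation mu := (mobius L).

Lemma properG A B : (A \proper B) = (A != B) && (A \subset B).
Proof. by rewrite finset.properEneq. Qed.

Lemma mobius_sum A B : A \in L -> B \in L -> A \subset B ->
  \sum_(U in L | (A \subset U) && (U \subset B)) mu A U = (A == B)%:Z.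
Proof.
move=> LA LB AB; rewrite (bigD1 B) /=; last by rewrite LB AB fintype.subxx.
rewrite (eq_bigl (fun U => (U \in L) && ((A \subset U) && (U \proper B)))); last first.
  by move=> U; rewrite properG -!andbA [(U \subset B) && _]andbC.
have [E|nAB] := eqVneq A B.
  rewrite E mobiusxx big1 ?addr0 // => U /andP[_ /andP[BU UB]].
  by move: (sub_proper_trans BU UB); rewrite fintype.properxx.
by rewrite mobius_lt ?properG ?nAB // addrC subrr.
Qed.

(** The defining recursion says that the Moebius function is a left inverse of the zeta
    function; this is the assertion that it is a right inverse.  Evaluating the sum of
    [mu A U * mu W B] over [U] below [W] in two orders proves it by induction on the
    size of the interval. *)
Lemma mobius_dual_sum A B : A \in L -> B \in L -> A \proper B ->
  \sum_(U in L | (A \subset U) && (U \subset B)) mu U B = 0.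
Proof.
move=> + LB; have [n] := ubnP (#|B| - #|A|); elim: n A => // n IH A; rewrite ltnS => An LA AB.
have sAB := proper_sub AB.
pose f U := \sum_(W in L | (U \subset W) && (W \subset B)) mu W B.
have fB : f B = 1.
  rewrite /f (bigD1 B) /=; last by rewrite LB fintype.subxx.
  rewrite mobiusxx big1 ?addr0 // => W /andP[/andP[_ /andP[BW WB]] nWB].
  by move: nWB; rewrite -val_eqE finset.eqEsubset BW WB.
have double : \sum_(U in L | (A \subset U) && (U \subset B)) mu A U * f U = mu A B.
  under eq_bigr do rewrite /f mulr_sumr.
  rewrite (exchange_big_dep (fun W => (W \in L) && ((A \subset W) && (W \subset B)))) /=; last first.
    move=> U W /andP[LU /andP[AU UB]] /andP[LW /andP[UW WB]].
    by rewrite LW WB (fintype.subset_trans AU UW).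
  transitivity (\sum_(W in L | (A \subset W) && (W \subset B)) (A == W)%:Z * mu W B).
    apply: eq_bigr => W /andP[LW /andP[AW WB]]; rewrite -mulr_suml -mobius_sum //.
    congr (_ * _); apply: eq_bigl => U; rewrite LW WB andbT /=.
    apply/andP/andP=> [[/andP[-> /andP[-> _]] -> //]|[-> /andP[-> UW]]].
    by rewrite UW (fintype.subset_trans UW WB).
  rewrite (bigD1 A) /=; last by rewrite LA sAB fintype.subxx.
  rewrite eqxx mul1r big1 ?addr0 // => W /andP[_ /negPf nWA].
  by rewrite eq_sym nWA mul0r.
have nBA : B != A by move: AB; rewrite properG eq_sym => /andP[].
move: double; rewrite (bigD1 A) /=; last by rewrite LA sAB fintype.subxx.
rewrite mobiusxx mul1r (bigD1 B) /=; last by rewrite LB sAB fintype.subxx nBA.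
rewrite fB mulr1 big1 => [|U /andP[/andP[/andP[LU /andP[AU UB]] nUA] nUB]].
  by rewrite addr0 -[RHS]add0r => /addIr.
have pUB : U \proper B by rewrite properG nUB.
have pAU : A \proper U by rewrite properG eq_sym nUA.
rewrite /f IH ?mulr0 //; have := proper_card pUB; have := proper_card pAU; lia.
Qed.

End DualMoebius.

Section CosetSums.

(** Adding or removing a fixed element of [C] is a sign-reversing involution. *)
Lemma alternating_subsets (T : finType) (C : {set T}) : C != finset.set0 ->
  \sum_(S : {set T} | S \subset C) (-1) ^+ #|S| = 0 :> int.
Proof.
move=> /set0Pn[a aC]; rewrite (bigID (fun S : {set T} => a \in S)) /=.
set s1 := \sum_(S | _) _; set s2 := \sum_(S | _) _.
suff -> : s1 = - s2 by rewrite addNr.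
rewrite /s1 (reindex_onto (fun S => a |: S) (fun S => S :\ a)) /=; last first.
  by move=> S /andP[_ aS]; rewrite finset.setD1K.
rewrite /s2 -sumrN; apply: eq_big => [S|S].
  rewrite setU11 andbT finset.subUset finset.sub1set aC /=.
  have [aS|aS] := boolP (a \in S); last by rewrite finset.setU1K ?eqxx ?andbT.
  by rewrite andbF; apply/negbTE/negP => /andP[_ /eqP E]; move: aS; rewrite -E !inE eqxx.
move=> /andP[_ /eqP aS]; have {}aS : a \notin S by rewrite -aS !inE eqxx.
by rewrite cardsU1 aS add1n exprS mulN1r.
Qed.

Lemma alternating_nonempty_subsets (T : finType) (C : {set T}) : C != finset.set0 ->
  \sum_(S : {set T} | (S != finset.set0) && (S \subset C)) (-1) ^+ #|S| = -1 :> int.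
Proof.
move=> /alternating_subsets; rewrite (bigD1 finset.set0) ?finset.sub0set //= cards0 expr0 addrC.
move=> /eqP; rewrite addr_eq0 => /eqP E; rewrite -[RHS]E; apply: eq_bigl => S; exact: andbC.
Qed.

Variables (gT : finGroupType) (q : nat) (G : {group gT}).

Definition within_coset (A : {group gT}) (S : {set gT}) :=
  [exists y in G, S \subset (y *: A)%g].

(** A nonempty set lies in at most one coset of [A], and each of the cosets contributes
    -1. *)
Lemma sum_within_coset (A : {group gT}) : A \subset G ->
  \sum_(S : {set gT} | (S != finset.set0) && within_coset A S) (-1) ^+ #|S| =
  - #|G : A|%g%:Z.
Proof.
move=> AG; rewrite -card_lcosets.
have sub (S : {set gT}) y : S != finset.set0 -> S \subset (y *: A)%g ->
    (fingroup.repr S *: A = y *: A)%g.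
  move=> /set0Pn[x xS] /fintype.subsetP SyA; apply/lcoset_eqP.
  by apply: SyA; exact: mem_repr xS.
rewrite (partition_big (fun S : {set gT} => (fingroup.repr S *: A)%g)
  (mem (lcosets A G))) /=; last first.
  move=> S /andP[S0 /exists_inP[y yG yA]]; rewrite (sub _ y) //.
  by apply/imsetP; exists y => //; rewrite lcosetE.
transitivity (\sum_(C in lcosets A G) (-1) : int); last first.
  by rewrite sumr_const mulNrn natz.
apply: eq_bigr => C /imsetP[y yG ->]; rewrite lcosetE.
rewrite -[RHS](@alternating_nonempty_subsets _ (y *: A)%g); last first.
  by apply/set0Pn; exists y; exact: lcoset_refl.
apply: eq_bigl => S; apply/andP/andP.
  move=> [/andP[S0 /exists_inP[z zG zA]] /eqP]; rewrite (sub _ z) // => <-.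
  by split.
move=> [S0 SyA]; rewrite S0 (sub _ y) // eqxx; split=> //.
by apply/exists_inP; exists y.
Qed.

(** The smallest subgroup having a coset that contains [S]. *)
Definition spread (S : {set gT}) : {group gT} := <<(fingroup.repr S)^-1 *: S>>%G.

Lemma within_cosetE (A : {group gT}) S : S != finset.set0 -> A \subset G ->
  within_coset A S = (fingroup.repr S \in G) && (spread S \subset A).
Proof.
move=> /set0Pn[x xS] AG; have rS := mem_repr _ xS.
apply/exists_inP/andP.
  move=> [y yG SyA]; have ry := fintype.subsetP SyA _ rS.
  split.
    move: ry; rewrite mem_lcoset -{2}(mulKVg y (fingroup.repr S)).
    by move=> /(fintype.subsetP AG); exact: groupM.
  rewrite gen_subG; apply/fintype.subsetP => _ /lcosetP[z zS ->].
  by rewrite -mem_lcoset (lcoset_eqP ry); exact: (fintype.subsetP SyA).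
move=> [rG SA]; exists (fingroup.repr S) => //; apply/fintype.subsetP => z zS.
by rewrite mem_lcoset; apply: (fintype.subsetP SA); apply/mem_gen/lcosetP; exists z.
Qed.

Lemma Nq_sub (A H : {group gT}) : A \in Nq q G -> H \subset A -> H \in Nq q G.
Proof.
rewrite !inE => /andP[AG LA] HA; rewrite (sub_proper_trans HA AG) /=.
by rewrite -subG1 -(eqP LA); exact: lcnS.
Qed.

Lemma sum_mobius_above (H : {group gT}) : H \in Nq q G ->
  \sum_(A in Nq q G | H \subset A) mobius (Lq q G) A G = -1.
Proof.
move=> NH; have HG : H \proper G by move: NH; rewrite inE => /andP[].
have LG : G \in Lq q G by rewrite !inE eqxx.
have LH : H \in Lq q G by rewrite finset.inE NH orbT.
have := mobius_dual_sum LH LG HG.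
rewrite (bigD1 G) /=; last by rewrite LG (proper_sub HG) fintype.subxx.
rewrite mobiusxx => /eqP; rewrite addrC addr_eq0 => /eqP E; rewrite -[RHS]E.
apply: eq_bigl => A; rewrite !inE.
have [->|nAG] := eqVneq A G; first by rewrite andbF fintype.properxx.
rewrite andbT orFb; have [AG|nAG'] := boolP (A \proper G); last by [].
by rewrite (proper_sub AG) andbT.
Qed.

Lemma sum_subsets_in_coset :
  \sum_(S : {set gT} | (S != finset.set0) && in_coset q G S) (-1) ^+ #|S| =
  \sum_(A in Nq q G) mobius (Lq q G) A G * #|G : A|%g%:Z.
Proof.
have NG A : A \in Nq q G -> A \subset G.
  by rewrite inE => /andP[/proper_sub].
transitivity (- \sum_(A in Nq q G) mobius (Lq q G) A G *
    \sum_(S : {set gT} | (S != finset.set0) && within_coset A S) (-1) ^+ #|S|); last first.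
  rewrite -sumrN; apply: eq_bigr => A /NG AG.
  by rewrite sum_within_coset // mulrN opprK.
under [in RHS]eq_bigr do rewrite mulr_sumr.
rewrite (exchange_big_dep (fun S : {set gT} => (S != finset.set0) && in_coset q G S)) /=; last first.
  move=> A S NA /andP[-> wA]; apply/exists_inP; by exists A.
rewrite -sumrN; apply: eq_bigr => S /andP[S0 /exists_inP[H NH wH]].
rewrite -mulr_suml (eq_bigl (fun A => (A \in Nq q G) && (spread S \subset A))).
  have := wH; rewrite -/(within_coset H S) within_cosetE ?NG // => /andP[_ SH].
  by rewrite (sum_mobius_above (Nq_sub NH SH)) mulN1r opprK.
move=> A; have [NA|//] := boolP (A \in Nq q G); rewrite S0 /=.
have := wH; rewrite -/(within_coset H S) within_cosetE ?NG // => /andP[rG _].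
by rewrite within_cosetE ?NG // rG.
Qed.

End CosetSums.

(** * The Euler characteristic of E(q, G) *)

Theorem proposition4p4 (R : realType) (q : nat) (gT : finGroupType)
    (G : {group gT}) (hq : (2 <= q)%N) (hG : ('L_q(G) != 1)%g) :
  exists chi : int,
    is_euler_characteristic R (E_space q G R) chi /\
    (chi%:~R : R[i]) = Pq q G (-1 : R[i]).
Proof.
exists (- \sum_(S : {set gT} | (S != finset.set0) && in_coset q G S) (-1) ^+ #|S|).
split.
  apply: (@nerve_euler_characteristic R (E_space q G R) gT (star (R := R) (q := q) (G := G))).
  - exact: star_open.
  - exact: star_cover.
  - move=> S S0 KS; exists (star_contract (R := R) S0), (star_center R q G S).
    by split; [exact: star_contracts|exact: star_center_mem].
  - by move=> S _ NS; exact: star_empty.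
rewrite sum_subsets_in_coset /Pq rmorphN rmorph_sum; congr (- _).
apply: eq_bigr => A; rewrite inE => /andP[AG _].
by rewrite rmorphM /= opprK nat_cpow1.
Qed.
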